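(* Put $r=(q+1)/2$, let $\mathbb{P}^1(\mathbb{F}_q)=\coprod_{i=1}^r\{a_i,b_i\}$ be a decomposition into $r$ pairs, and for $\kappa\geqslant1$ let $$f_\kappa^T(z)=\sum_{\gamma\in\Gamma(T)}\prod_{i=1}^ru(z;\gamma a_i,\gamma b_i)^\kappa.$$ For every $\kappa\in\{p^j\kappa':j\geqslant0,\ 1\leqslant\kappa'\leqslant q-1\}$ we have $f_\kappa^T=(f_1^T)^\kappa$. Moreover $$\Delta=-(f_1^T)^{q-1}=-f_{q-1}^T.$$
   Context: $q=p^e$ is an odd prime power with $p$ prime, $A=\mathbb{F}_q[T]$, $G=\mathrm{GL}_2(A)$, $F_\infty=\mathbb{F}_q((1/T))$, $\mathbb{C}_\infty$ is the completion of an algebraic closure of $F_\infty$, $z\in\Omega=\mathbb{C}_\infty\setminus F_\infty$. $\Gamma(T)=\ker(\mathrm{GL}_2(A)\to\mathrm{GL}_2(A/TA))$. $u(z;a,b)=\frac1{z-b}-\frac1{z-a}$ with $\frac1{z-\infty}=0$. The series $f_\kappa^T$ converge locally uniformly on $\Omega$. $\Delta=-h^{q-1}$, where, with $e_A(z)=z\prod_{b\in A\setminus\{0\}}(1-z/b)$, $t_A=1/e_A$, $j_\gamma(z)=cz+d$ for $\gamma=\begin{pmatrix}a&b\\c&d\end{pmatrix}$, and $K=\begin{pmatrix}\mathbb{F}_q^\times&A\\0&1\end{pmatrix}$, $$h(z)=\sum_{[\gamma]\in K\backslash G}\frac{\det\gamma}{j_\gamma(z)^{q+1}}\,t_A(\gamma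 z).$$ *)

(* Defs.v *)
From HB Require Import structures.
From mathcomp Require Import all_boot all_order all_algebra finmap generic_quotient.
From mathcomp Require Import boolp classical_sets reals topology normedtype.
From mathcomp Require Import sequences showcase.summability.
Set Implicit Arguments.
Unset Strict Implicit.
Unset Printing Implicit Defensive.
Import Order.TTheory GRing.Theory Num.Theory.
Local Open Scope classical_set_scope.
Local Open Scope quotient_scope.
Local Open Scope ring_scope.

(* A non-archimedean norm is not a norm in the sense of normedZmodType (which
   requires |x *+ n| = |x| *+ n), hence the following structure. *)
Record valuedField (R : realType) := ValuedField {
  valued_field : fieldType;
  absv : valued_field -> R;
  absv_ge0 : forall x, 0 <= absv x;
  absv_eq0 : forall x, (absv x == 0) = (x == 0);
  absvM : {morph absv : x y / x * y};
  absvD : forall x y, absv (x + y) <= Num.max (absv x) (absv y) }.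

Definition valued_sort (R : realType) (C : valuedField R) : Type :=
  valued_field C.
Coercion valued_sort : valuedField >-> Sortclass.

Section ValuedFieldTopology.
Variables (R : realType) (C : valuedField R).

HB.instance Definition _ := GRing.Field.copy C (valued_field C).
HB.instance Definition _ := isPointed.Build C (0 : valued_field C).

Definition abs_dist (x y : C) : R := absv (x - y : valued_field C).

Lemma absvN (x : valued_field C) : absv (- x) = absv x.
Proof.
have h1 : absv (1 : valued_field C) = 1.
  have n0 : absv (1 : valued_field C) != 0 by rewrite absv_eq0 oner_neq0.
  by apply: (mulfI n0); rewrite -absvM !mulr1.
have hN1 : absv (- 1 : valued_field C) = 1.
  have := absvM (-1 : valued_field C) (-1); rewrite mulrNN mulr1 h1 => /esym/eqP.
  rewrite -expr2 sqrf_eq1 => /orP[/eqP //|/eqP hm].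
  by have := absv_ge0 (-1 : valued_field C); rewrite hm oppr_ge0 ler10.
by rewrite -mulN1r absvM hN1 mul1r.
Qed.

Lemma abs_distxx x : abs_dist x x = 0.
Proof. by apply/eqP; rewrite absv_eq0 subrr. Qed.

Lemma abs_dist_eq0 x y : abs_dist x y = 0 -> x = y.
Proof. by move/eqP; rewrite absv_eq0 subr_eq0 => /eqP. Qed.

Lemma abs_dist_sym x y : abs_dist x y = abs_dist y x.
Proof. by rewrite /abs_dist -absvN opprB. Qed.

Lemma abs_dist_triangle y x z :
  abs_dist x z <= abs_dist x y + abs_dist y z.
Proof.
rewrite /abs_dist -(subrKA (y : valued_field C)).
apply: le_trans (absvD _ _) _.
by rewrite ge_max lerDl lerDr !absv_ge0.
Qed.

HB.instance Definition _ := @isMetric.Build R C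
  abs_dist abs_distxx abs_dist_eq0 abs_dist_sym abs_dist_triangle.

End ValuedFieldTopology.

(* Sums and products over an arbitrary index type are unordered: limits along
   the directed set of finite subsets (and an arbitrary value in case of
   divergence). *)
Definition usum {I : choiceType} {R : realType}
    {C : valuedField R} (x : I -> C) : C :=
  lim ((fun S : {fset I} => \sum_(i <- S) x i) @ totally).

Definition uprod {I : choiceType} {R : realType}
    {C : valuedField R} (x : I -> C) : C :=
  lim ((fun S : {fset I} => \prod_(i <- S) x i) @ totally).

Section Cinfty.
Variables (R : realType) (F : finFieldType) (C : valuedField R).
Variable iota : {rmorphism {poly F} -> C}.

Local Notation A := {poly F}.
Local Notation q := #|F|.

(* F((1/T)) inside C: the sums of the Laurent series
   \sum_(i >= 0) c_i T^(N - i) with coefficients in F. *)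
Definition Finfty : set C :=
  [set x | exists (N : nat) (c : nat -> F),
     series (fun i => iota (c i)%:P * iota 'X ^+ N / iota 'X ^+ i) @ \oo --> x].

Definition algebraic_over_Finfty : set C :=
  [set x | exists p : {poly C},
     [/\ p != 0, forall i, Finfty p`_i & root p x]].

(* C, with the structure map iota : F[T] -> C, is the completion of an algebraic
   closure of F((1/T)), the absolute value being normalized by |T| = q. This
   determines C up to isometric isomorphism over F[T]. *)
Record is_Cinfty : Prop := IsCinfty {
  Cinfty_complete : forall G : set_system C, ProperFilter G -> cauchy G -> cvg G;
  Cinfty_normT : absv (iota 'X : valued_field C) = q%:R;
  Cinfty_alg_closed : forall p : {poly C},
    (forall i, algebraic_over_Finfty p`_i) -> size p != 1%N ->
    exists x, root p x;
  Cinfty_dense : closure algebraic_over_Finfty = setT }.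

Definition Omega : set C := ~` Finfty.

(* P^1(K) is option K, with None for the point at infinity. *)
Definition P1act (M : 'M[C]_2) (x : option C) : option C :=
  let: (num, den) :=
    if x is Some y then (M 0 0 * y + M 0 1, M 1 0 * y + M 1 1)
    else (M 0 0, M 1 0) in
  if den == 0 then None else Some (num / den).

Definition P1const (x : option F) : option C :=
  omap (fun c : F => iota c%:P) x.

(* u(z; a, b) = 1/(z - b) - 1/(z - a), where 1/(z - oo) = 0. *)
Definition u (z : C) (a b : option C) : C :=
  let pole x := if x is Some y then (z - y)^-1 else 0 in
  pole b - pole a.

Definition GL2A := {g : 'M[A]_2 | g \in unitmx}.

Definition GammaT :=
  {g : 'M[A]_2 | (g \in unitmx) && (map_mx (in_qpoly 'X) g == 1%:M)}.

Definition pair_decomposition (a b : 'I_((q + 1) %/ 2) -> option F) : Prop :=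
  [/\ forall i, a i != b i,
      trivIset setT (fun i => [set a i; b i])
    & \bigcup_i [set a i; b i] = setT].

Definition f_series (a b : 'I_((q + 1) %/ 2) -> option F) (kappa : nat) (z : C) : C :=
  usum (fun g : GammaT =>
    \prod_i u z (P1act (map_mx iota (val g)) (P1const (a i)))
                (P1act (map_mx iota (val g)) (P1const (b i))) ^+ kappa).

Definition e_A (z : C) : C :=
  z * uprod (fun b : {b : A | b != 0} => 1 - z / iota (val b)).

Definition t_A (z : C) : C := (e_A z)^-1.

Definition automorphy (M : 'M[C]_2) (z : C) : C := M 1 0 * z + M 1 1.

Definition mobius (M : 'M[C]_2) (z : C) : C :=
  (M 0 0 * z + M 0 1) / automorphy M z.

Definition in_K (k : 'M[A]_2) : Prop :=
  exists (c : F) (d : A), c != 0 /\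
    k = \matrix_(i, j) if i == 0 then (if j == 0 then c%:P else d)
                       else (if j == 0 then 0 else 1).

Definition K_coset (g1 g2 : GL2A) : bool :=
  `[< exists2 k, in_K k & val g2 = k *m val g1 >].

Lemma K_coset_equiv : equiv_class_of K_coset.
Proof.
pose m (c : F) d : 'M[{poly F}]_2 :=
  \matrix_(i, j) if i == 0 then (if j == 0 then c%:P else d)
                 else (if j == 0 then 0 else 1).
have mM c d c' d' : m c d *m m c' d' = m (c * c') (c%:P * d' + d).
  apply/matrixP => i j; rewrite !mxE !big_ord_recl big_ord0 !mxE /=.
  case: (i == 0); case: (j == 0); rewrite /= ?polyCM ?mulr0 ?mulr1 ?mul0r ?mul1r
    ?addr0 ?add0r //.
have m1 : m 1 0 = 1%:M.
  apply/matrixP => i j; rewrite !mxE.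
  by case: i j => [[|[|]] //= ?] [[|[|]] //= ?].
have inK c d : c != 0 -> in_K (m c d) by exists c, d.
split.
- move=> g; apply/asboolP; exists 1%:M; last by rewrite mul1mx.
  by rewrite -m1; apply: inK; rewrite oner_neq0.
- have sym g1 g2 : K_coset g1 g2 -> K_coset g2 g1.
    move=> /asboolP[k [c [d [c0 ->]]] e].
    apply/asboolP; exists (m c^-1 (- (c^-1)%:P * d)).
      by apply: inK; rewrite invr_eq0.
    rewrite e -/(m c d) mulmxA mM mulVf // mulNr subrr m1 mul1mx //.
  by move=> g1 g2; apply/idP/idP; apply: sym.
- move=> g2 g1 g3 /asboolP[k [c [d [c0 ->]]] e] /asboolP[k' [c' [d' [c0' ->]]] e'].
  apply/asboolP; exists (m (c' * c) (c'%:P * d + d')).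
    by apply: inK; rewrite mulf_neq0.
  by rewrite e' e -/(m c d) -/(m c' d') mulmxA mM.
Qed.

Canonical K_coset_equiv_rel := EquivRelPack K_coset_equiv.

(* The sum is over the cosets K g in K \ GL_2(A); the summand only depends on
   the coset of g. *)
Definition h (z : C) : C :=
  usum (fun x : {eq_quot K_coset_equiv_rel} =>
    let M := map_mx iota (val (repr x)) in
    \det M / automorphy M z ^+ (q + 1) * t_A (mobius M z)).

Definition Delta (z : C) : C := - h z ^+ (q - 1).

End Cinfty.

(* Main.v *)
(** Put [A = F[T]], [Lambda = A z + A] and [M(x, y) = x y^q - x^q y].  For [g]
    in Gamma(T) the factors of the summand of [f_kappa] combine into
    [eps^kappa / M(X, Y)^kappa], where [X, Y] is the basis of [Lambda] given by
    [g] and [eps] is a constant in [F^*]; so with [E_kappa] the sum of the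
    [M(X, Y)^-kappa] one needs [E_kappa = E_1^kappa] and [h = - E_1].

    The first identity already holds for finite partial sums.  Let [U] be the
    space of the [a X + b Y] with [deg a <= i], [deg b <= j], and sum over the
    bases contained in [U].  Such a basis lies in exactly one, or in all
    [q + 1 = 1], of the [q + 1] subspaces of the same kind obtained by requiring
    the leading coefficients to lie on a given line of [F^2] (these are the
    neighbours in the Bruhat-Tits tree).  Hence the sum over [U] is the sum over
    its neighbours.  By induction the sums over the neighbours are the values on
    the projective line over [F] of a quotient of two [F]-linear forms, for which
    the [kappa]-th power sum is the [kappa]-th power of the sum
    ([kappa <= q - 1]).  The closed form carried along the induction is
    [C D^(q+1) / M(e(T^i X), e(T^j Y))], where [e] is the monic [F]-linear
    polynomial vanishing on the span of the [T^m X] ([m < i]) and [T^m Y]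
    ([m < j]), [D] is its coefficient of degree 1, and [C] depends on [i + j]
    only.

    For the second identity both sides are regroupings of the sum of
    [1 / ((c z + d)^q (a z + b))] over SL_2(A): by cosets of [K] it gives [h],
    since the reciprocal of [e_A] is the sum of the [1 / (w - a)], and by the
    finite group SL_2(F) it gives [- E_1]. *)

Require Import Defs.
From mathcomp Require Import all_boot all_order all_algebra.
From mathcomp Require Import all_field finmap generic_quotient.
From mathcomp Require Import boolp classical_sets reals topology normedtype.
From mathcomp Require Import sequences showcase.summability ring lra zify.
Set Implicit Arguments.
Unset Strict Implicit.
Unset Printing Implicit Defensive.
Import Order.TTheory GRing.Theory Num.Theory.
Local Open Scope quotient_scope.
Local Open Scope ring_scope.

(** * F_q-linear functions and Moore determinants *)

Section FqLinear.
Variables (F : finFieldType) (L : fieldType) (iota : {rmorphism {poly F} -> L}).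
Variables (p e : nat).
Hypotheses (p_pr : prime p) (card_F : #|F| = (p ^ e)%N) (q_odd : odd #|F|).
Local Notation r := #|F|.-1.
Local Notation k c := (iota c%:P).
Local Notation T := (iota 'X).

Lemma card_predK : r.+1 = #|F|.
Proof. by rewrite prednK // (cardD1 0). Qed.

Lemma pred_card_gt0 : (0 < r)%N.
Proof. by rewrite -ltnS card_predK finNzRing_gt1. Qed.

Lemma exp_sub_sym (x y : L) : (x - y) ^+ r = (y - x) ^+ r.
Proof.
rewrite -opprB exprNn -signr_odd.
by have := q_odd; rewrite -card_predK /= => /negbTE ->; rewrite mul1r.
Qed.

Lemma exprN_even (x : L) : (- x) ^+ r = x ^+ r.
Proof. by have := exp_sub_sym x 0; rewrite sub0r subr0. Qed.

Lemma iota_const_eq0 c : (k c == 0) = (c == 0).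
Proof. exact: (fmorph_eq0 (iota \o polyC)). Qed.

Lemma pchar_p : p \in [pchar L].
Proof. exact: (rmorph_pchar (iota \o polyC) (card_finPcharP card_F p_pr)). Qed.

Lemma card_pnat : [pchar L].-nat r.+1.
Proof.
by rewrite card_predK card_F (eq_pnat _ (pcharf_eq pchar_p)) pnatX pnat_id.
Qed.

Lemma card_natr0 : #|F|%:R = 0 :> L.
Proof.
rewrite card_F; apply/eqP; rewrite -(dvdn_pcharf pchar_p) dvdn_exp //.
by case: e card_F (finNzRing_gt1 F) => [->|].
Qed.

Lemma frobD (x y : L) : (x + y) ^+ r.+1 = x ^+ r.+1 + y ^+ r.+1.
Proof. exact: exprDn_pchar card_pnat. Qed.

Lemma frobN (x : L) : (- x) ^+ r.+1 = - x ^+ r.+1.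
Proof. exact: exprNn_pchar card_pnat. Qed.

Lemma frobB (x y : L) : (x - y) ^+ r.+1 = x ^+ r.+1 - y ^+ r.+1.
Proof. by rewrite frobD frobN. Qed.

Lemma frob_const c : k c ^+ r.+1 = k c.
Proof. by rewrite -rmorphXn -polyC_exp card_predK expf_card. Qed.

(** * Products and power sums over a line *)

Lemma prod_line_monic (w : L) : \prod_c (w - k c) = w ^+ r.+1 - w.
Proof.
have /(congr1 (fun P => (map_poly (iota \o polyC) P).[w])) := finField_genPoly F.
rewrite rmorphB rmorph_prod /= horner_prod map_polyXn map_polyX !hornerE card_predK.
by move=> ->; apply: eq_bigr => c _; rewrite rmorphB /= map_polyX map_polyC !hornerE.
Qed.

Lemma prod_line (x y : L) : \prod_c (y + k c * x) = y ^+ r.+1 - x ^+ r * y.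
Proof.
have [->|x0] := eqVneq x 0.
  under eq_bigr do rewrite mulr0 addr0.
  by rewrite prodr_const card_predK expr0n gtn_eqF ?pred_card_gt0 // mul0r subr0.
transitivity (\prod_c (x * (y / x - k c))).
  rewrite (reindex_inj oppr_inj) /=; apply: eq_bigr => c _.
  by rewrite polyCN rmorphN /= mulrBr mulrCA divff // mulr1 mulNr [k c * x]mulrC.
rewrite prodrMl prod_line_monic -card_predK expr_div_n !exprS /=.
by field; rewrite expf_neq0 x0.
Qed.

Lemma frob_fixed (x : L) : x ^+ r.+1 = x -> exists c, x = k c.
Proof.
move=> fx; have /eqP/prodf_eq0[c _ /eqP e0] : \prod_c (x - k c) = 0.
  by rewrite prod_line_monic fx subrr.
by exists c; apply/eqP; rewrite -subr_eq0 e0.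
Qed.

Lemma sum_inv_roots (I : Type) (s : seq I) (f : I -> L) (w : L) :
    \prod_(i <- s) (w - f i) != 0 ->
  \sum_(i <- s) (w - f i)^-1 =
    (\prod_(i <- s) ('X - (f i)%:P))^`().[w] / \prod_(i <- s) (w - f i).
Proof.
elim: s => [|a s IHs]; first by rewrite !big_nil derivC hornerC mul0r.
rewrite !big_cons mulf_eq0 negb_or => /andP[a0 s0].
rewrite IHs // derivM derivXsubC mul1r !hornerE horner_prod.
under [in RHS]eq_bigr do rewrite !hornerE.
by field; rewrite a0 s0.
Qed.

(** The logarithmic derivative of X^q - X, whose derivative is -1 because q = 0 in [L]. *)
Lemma sum_line_inv_monic (w : L) : (forall c, w != k c) ->
  \sum_c (w - k c)^-1 = - (w ^+ r.+1 - w)^-1.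
Proof.
move=> wP; rewrite sum_inv_roots ?prod_line_monic; last first.
  by rewrite -prod_line_monic; apply/prodf_neq0 => c _; rewrite subr_eq0.
have -> : \prod_c ('X - (k c)%:P) = 'X^(r.+1) - 'X.
  have := congr1 (map_poly (iota \o polyC)) (finField_genPoly F).
  rewrite rmorphB rmorph_prod /= map_polyXn map_polyX -card_predK => ->.
  by apply: eq_bigr => c _; rewrite rmorphB /= map_polyX map_polyC.
have q0 : r.+1%:R = 0 :> L by rewrite card_predK card_natr0.
rewrite derivB derivX derivXn hornerD hornerN hornerMn hornerXn hornerC.
by rewrite -mulr_natl q0 mul0r sub0r mulN1r.
Qed.

(** Substituting g c for c multiplies the sum by [g ^- m], so it vanishes once some [g ^+ m] differs
    from 1. Such a [g] exists, as X^m - 1 has at most m < q - 1 roots. *)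
Lemma sum_expV m : (0 < m < r)%N -> \sum_(c : F | c != 0) c ^- m = 0.
Proof.
move=> /andP[m0 mr].
have [g g0 gm] : exists2 g : F, g != 0 & g ^+ m != 1.
  pose P := 'X^m - 1 : {poly F}.
  have [g /andP[]|H] := pickP (fun g : F => (g != 0) && (g ^+ m != 1)).
    by exists g.
  have rP : all (root P) (enum [pred c : F | c != 0]).
    apply/allP => c; rewrite mem_enum inE => c0.
    by have := H c; rewrite c0 /= rootE !hornerE subr_eq0 => /negbFE.
  have P0 : P != 0 by rewrite -size_poly_eq0 size_XnsubC.
  have := max_poly_roots P0 rP (enum_uniq _).
  rewrite size_XnsubC // -cardE ltnS leqNgt; case/negP.
  apply: leq_trans mr _.
  by rewrite -ltnS card_predK (cardD1 0) ltnS; apply: subset_leq_card; apply/fintype.subsetP => c; rewrite !inE andbT.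
have: \sum_(c : F | c != 0) c ^- m = g ^- m * \sum_(c : F | c != 0) c ^- m.
  rewrite {1}(reindex_inj (mulfI g0)) big_distrr /=.
  apply: eq_big => c; first by rewrite mulf_eq0 negb_or g0.
  by rewrite exprMn invfM.
move/eqP; rewrite -subr_eq0 -{1}[\sum_(_ | _) _]mul1r -mulrBl mulf_eq0.
by rewrite subr_eq0 eq_sym invr_eq1 (negbTE gm) => /eqP.
Qed.

Lemma sum_line_inv (x y : L) : x != 0 -> (forall c, y + k c * x != 0) ->
  \sum_c (y + k c * x)^-1 = - x ^+ r / (y ^+ r.+1 - x ^+ r * y).
Proof.
move=> x0 yP.
have -> : \sum_c (y + k c * x)^-1 = \sum_c x^-1 * (y / x - k c)^-1.
  rewrite (reindex_inj oppr_inj) /=; apply: eq_bigr => c _.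
  by rewrite polyCN rmorphN /= -invfM mulrBr mulrCA divff // mulr1 mulNr [k c * x]mulrC.
have y1 : y ^+ r.+1 - x ^+ r * y != 0 by rewrite -prod_line; apply/prodf_neq0.
rewrite -big_distrr /= sum_line_inv_monic => [|c]; last first.
  have := yP (- c); apply: contraNneq => yE.
  by rewrite polyCN rmorphN /= -yE mulNr divfK // subrr.
have -> : (y / x) ^+ r.+1 - y / x = (y ^+ r.+1 - x ^+ r * y) / x ^+ r.+1.
  by rewrite expr_div_n mulrBl [x ^+ r * y]mulrC [in X in _ = _ - X]exprS -mulf_div divff ?expf_neq0 // mulr1.
rewrite invf_div exprSr; move: y1; set d := _ - _ => d0.
by field; rewrite x0 d0.
Qed.

(** Induction on [m]: the [m]-th power sum times the sum of the 1/(w - c) is the next power sum plus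
    the off-diagonal terms [S m 0], and these cancel. *)
Lemma psum_line_inv (w : L) m : (forall c, w != k c) -> (0 < m <= r)%N ->
  \sum_c (w - k c) ^- m = (\sum_c (w - k c)^-1) ^+ m.
Proof.
move=> wP /andP[m0 mr].
pose v c := (w - k c)^-1.
pose S j n := \sum_c \sum_(d : F | d != 0) v c ^+ j * v (c - d) * k (d ^- n).
have vD c d : d != 0 -> v c * v (c - d) = (v c - v (c - d)) * k d^-1.
  move=> d0; have kd0 : k d != 0 by rewrite iota_const_eq0.
  rewrite /v; have := wP c; have := wP (c - d); rewrite -![w == _]subr_eq0.
  have -> : k d^-1 = (k d)^-1 by exact: (fmorphV (iota \o polyC)).
  rewrite polyCB rmorphB /= => h1 h2; field.
  by rewrite kd0 h1 h2.
have ksum n : (0 < n < r)%N -> \sum_(d : F | d != 0) k (d ^- n) = 0.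
  by move=> nr; rewrite -(rmorph_sum (iota \o polyC)) sum_expV // rmorph0.
(* Each use of [vD] trades a factor [v c] for a factor [d^-1] and splits off a multiple of the sum
   of the [d ^- n.+1], which is 0. For [j = 0] the sum over [c] does not depend on [d]. *)
have S0 j n : (0 < j + n < r)%N -> S j n = 0.
  elim: j n => [|j IHj] n jn.
    rewrite /S exchange_big /=.
    under eq_bigr => d _ do under eq_bigr do rewrite mul1r.
    under eq_bigr => d _ do rewrite -big_distrl (reindex_inj (addIr d)) /=.
    under eq_bigr => d _ do under eq_bigr do rewrite addrK.
    by rewrite -big_distrr /= ksum ?mulr0 //; rewrite add0n in jn.
  have Sj : S j.+1 n = \sum_c v c ^+ j.+1 * \sum_(d : F | d != 0) k (d ^- n.+1) - S j n.+1.
    rewrite /S -sumrB; apply: eq_bigr => c _.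
    rewrite big_distrr -sumrB /=; apply: eq_bigr => d d0.
    rewrite exprSr -(mulrA _ (v c)) vD // !exprSr invfM polyCM rmorphM /=.
    by ring.
  rewrite Sj IHj ?addnS // subr0 ksum; last by move: jn; lia.
  by rewrite big1 // => c _; rewrite mulr0.
elim: m mr m0 => // m IHm mr _; have [->//|m0] := posnP m.
rewrite [RHS]exprSr -IHm // 1?ltnW //.
have := S0 m 0; rewrite addn0 m0 mr => /(_ isT).
move=> Sm; apply/eqP; rewrite -subr_eq0 -oppr_eq0 opprB; apply/eqP.
rewrite -[RHS]Sm /S big_distrl -sumrB; apply: eq_bigr => c _.
rewrite (reindex_inj (inj_comp (addrI c) oppr_inj)) /= (bigD1 0) //= subr0.
rewrite -exprVn mulrDr -exprVn -exprSr addrC addKr big_distrr /=.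
by apply: eq_bigr => d _; rewrite expr0 invr1 rmorph1 mulr1.
Qed.

(** * Moore determinants and power sums over the projective line *)

Definition moore2 (x y : L) := x * y ^+ r.+1 - x ^+ r.+1 * y.

Lemma moore2E x y : moore2 x y = x * (y ^+ r.+1 - x ^+ r * y).
Proof. by rewrite /moore2 !exprS; ring. Qed.

Lemma moore2_prod x y : moore2 x y = x * \prod_c (y + k c * x).
Proof. by rewrite prod_line moore2E. Qed.

(** With w = -y/x every finite value is [lx / x + d / (w - c)], so [psum_line_inv] applies to each
    term of the binomial expansion; [lx / x] is the value at infinity. *)
Lemma psum_line_mobius (lx ly x y : L) m :
    x != 0 -> (forall c, y + k c * x != 0) -> (0 < m <= r)%N ->
  (lx / x) ^+ m + \sum_c ((ly + k c * lx) / (y + k c * x)) ^+ m =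
  ((lx * y ^+ r.+1 - ly * x ^+ r.+1) / moore2 x y) ^+ m.
Proof.
move=> x0 yP mr.
pose w := - (y / x); pose d := (lx * y - ly * x) / x ^+ 2.
have wP c : w != k c.
  have := yP c; apply: contraNneq => wE.
  by rewrite -wE /w mulNr divfK // subrr.
have vE c : (ly + k c * lx) / (y + k c * x) = lx / x + d * (w - k c)^-1.
  rewrite /d /w; have := wP c; rewrite -subr_eq0 /w => ?; field.
  rewrite x0 yP andbT /=.
  by rewrite mulNr -opprD oppr_eq0 yP.
transitivity ((lx / x + d * \sum_c (w - k c)^-1) ^+ m).
  (* The constant term of the expansion occurs q = 0 times in the sum over [c]; the point at
     infinity supplies it. *)
  rewrite exprDn big_ord_recl /= subn0 mulr1 bin0 mulr1n; congr (_ + _).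
  under eq_bigr => c _ do rewrite vE exprDn big_ord_recl /= subn0 mulr1 bin0 mulr1n.
  rewrite big_split sumr_const /= card_F.
  rewrite -mulr_natr -card_F card_natr0 mulr0 add0r exchange_big /=.
  apply: eq_bigr => i _; rewrite sumrMnl -big_distrr /=; congr (_ * _ *+ _).
  rewrite exprMn -psum_line_inv; last 2 first.
  - by [].
  - by rewrite /= (leq_trans (ltn_ord i)) //; case/andP: mr.
  rewrite big_distrr /=; apply: eq_bigr => c _.
  by rewrite exprMn exprVn.
congr (_ ^+ m); rewrite sum_line_inv_monic //.
have y1 : y ^+ r.+1 - x ^+ r * y != 0.
  by rewrite -prod_line; apply/prodf_neq0.
have -> : w ^+ r.+1 - w = - ((y ^+ r.+1 - x ^+ r * y) / x ^+ r.+1).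
  rewrite /w frobN expr_div_n mulrBl opprB opprK addrC; congr (_ - _).
  by rewrite [x ^+ r * y]mulrC [in RHS]exprS -mulf_div divff ?expf_neq0 // mulr1.
rewrite invrN opprK invf_div moore2E /d.
have : y ^+ r.+1 = (y ^+ r.+1 - x ^+ r * y) + x ^+ r * y by rewrite subrK.
move: (y ^+ r.+1 - x ^+ r * y) y1 => D D0 ->.
by rewrite [x ^+ r.+1]exprS; field; rewrite D0 x0.
Qed.

(** * F-linear functions with prescribed zeros *)

(** The product over [c] of the [f x - c f y]: for F-linear [f], the kernel is enlarged by the line
    through [y]. *)
Definition step (f : L -> L) (y x : L) := f x ^+ r.+1 - f y ^+ r * f x.

(* [espan X Y i j] is the monic [F]-linear polynomial function whose zeros are
   the [a X + b Y] with [a], [b] in [F[T]], [size a <= i], [size b <= j]. *)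
Fixpoint espan1 (X : L) (i : nat) : L -> L :=
  if i is i'.+1 then step (espan1 X i') (T ^+ i' * X) else id.

Fixpoint espan (X Y : L) (i j : nat) : L -> L :=
  if j is j'.+1 then step (espan X Y i j') (T ^+ j' * Y) else espan1 X i.

(* The coefficient of degree 1 of [espan]. *)
Fixpoint dspan1 (X : L) (i : nat) : L :=
  if i is i'.+1 then - espan1 X i' (T ^+ i' * X) ^+ r * dspan1 X i' else 1.

Fixpoint dspan (X Y : L) (i j : nat) : L :=
  if j is j'.+1 then - espan X Y i j' (T ^+ j' * Y) ^+ r * dspan X Y i j'
  else dspan1 X i.

Definition Flinear (f : L -> L) :=
  forall c x y, f (x + k c * y) = f x + k c * f y.

Lemma step_ext f g y : f =1 g -> step f y =1 step g y.
Proof. by move=> fg x; rewrite /step !fg. Qed.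

Lemma step_Flinear f y : Flinear f -> Flinear (step f y).
Proof.
move=> fL c x z; rewrite /step fL frobD exprMn frob_const; ring.
Qed.

Lemma espan_Flinear X Y i j : Flinear (espan X Y i j).
Proof.
elim: j => [|j IHj] /=; last exact: step_Flinear.
by elim: i => [|i IHi] //=; apply: step_Flinear.
Qed.

Lemma Flinear0 f : Flinear f -> f 0 = 0.
Proof.
by move=> /(_ (-1) 0 0); rewrite polyCN !rmorphN1 !mulN1r subr0 subrr.
Qed.

Lemma FlinearZ f c x : Flinear f -> f (k c * x) = k c * f x.
Proof. by move=> fL; have := fL c 0 x; rewrite Flinear0 // !add0r. Qed.

Lemma stepE f y x : step f y x = f x * (f x ^+ r - f y ^+ r).
Proof. by rewrite /step exprS mulrBr [_ * f y ^+ r]mulrC. Qed.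

Lemma step_self f y : step f y y = 0.
Proof. by rewrite stepE subrr mulr0. Qed.

Lemma step0 f y x : f x = 0 -> step f y x = 0.
Proof. by rewrite stepE => ->; rewrite mul0r. Qed.

Lemma moore2_step f y x : moore2 (f y) (f x) = f y * step f y x.
Proof. exact: moore2E. Qed.

Lemma moore2_sym x y : moore2 x y = - moore2 y x.
Proof. by rewrite /moore2; ring. Qed.

(** Both orders enlarge the kernel by the same span. The check is computational: besides ring
    identities it takes [sq], the additivity of Frobenius on [b - a], and the evenness of q - 1. *)
Lemma step_comm f y z : step (step f y) z =1 step (step f z) y.
Proof.
move=> x; rewrite /step !frobB !exprMn.
have E (a b : L) : (b ^+ r.+1 - a ^+ r * b) ^+ r = b ^+ r * (b ^+ r - a ^+ r) ^+ r.
  by rewrite -exprMn exprS mulrBr; congr (_ ^+ _); ring.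
rewrite !E; set a := f y ^+ r; set b := f z ^+ r.
have sq : (b - a) * (b - a) ^+ r = b ^+ r.+1 - a ^+ r.+1 by rewrite -exprS frobB.
rewrite (exp_sub_sym a b) in sq *.
have -> : b ^+ r.+1 = a ^+ r.+1 + (b - a) * (b - a) ^+ r by rewrite sq subrKC.
by ring.
Qed.

Lemma espan_stepX X Y i j : espan X Y i.+1 j =1 step (espan X Y i j) (T ^+ i * X).
Proof.
elim: j => [|j IHj] x //=.
by rewrite (step_ext _ IHj) step_comm.
Qed.

Lemma espan_sym X Y i j : espan X Y i j =1 espan Y X j i.
Proof.
elim: i j => [|i IHi] j x.
  by elim: j x => [|j IHj] x //=; apply: step_ext.
rewrite espan_stepX /=; exact: step_ext.
Qed.

Lemma dspan_stepX X Y i j :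
  dspan X Y i.+1 j = - espan X Y i j (T ^+ i * X) ^+ r * dspan X Y i j.
Proof.
elim: j => [|j IHj] //=.
rewrite IHj !espan_stepX !stepE !exprMn.
by rewrite (exp_sub_sym (_ (_ * Y) ^+ r)); ring.
Qed.

Lemma dspan_sym X Y i j : dspan X Y i j = dspan Y X j i.
Proof.
elim: i j => [|i IHi] j.
  elim: j => [|j IHj] //=; rewrite IHj /= (espan_sym X Y); congr (- _ ^+ _ * _).
by rewrite dspan_stepX /= IHi espan_sym.
Qed.

Lemma espan_root1 X Y i j n : (n < i)%N -> espan X Y i j (T ^+ n * X) = 0.
Proof.
elim: i => // i IHi; rewrite ltnS leq_eqVlt espan_stepX => /predU1P[->|ni].
  exact: step_self.
exact/step0/IHi.
Qed.

Lemma espan_root2 X Y i j n : (n < j)%N -> espan X Y i j (T ^+ n * Y) = 0.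
Proof. by rewrite espan_sym; apply: espan_root1. Qed.

(** If [f y] is nonzero, [f x / f y] is fixed by Frobenius and hence a constant [c]; then [x - c y]
    lies in the kernel of [f]. *)
Lemma step_eq0 f y x : Flinear f -> step f y x = 0 ->
  exists c, f (x - k c * y) = 0.
Proof.
move=> fL; rewrite /step => /eqP; rewrite subr_eq0 => /eqP fx.
have [y0|y0] := eqVneq (f y) 0.
  exists 0; rewrite !rmorph0 mul0r subr0; apply/eqP.
  move/eqP: fx; rewrite y0 expr0n gtn_eqF ?pred_card_gt0 // mul0r.
  by rewrite expf_eq0.
have [|c cE] := @frob_fixed (f x / f y).
  by rewrite exprMn fx exprVn exprS; field; rewrite y0 expf_neq0.
exists c; rewrite -mulNr -[- k c]rmorphN -polyCN fL polyCN rmorphN -cE.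
by rewrite mulNr divfK // subrr.
Qed.

Lemma espan_eq0 X Y i j x : espan X Y i j x = 0 ->
  exists a b : {poly F}, [/\ (size a <= i)%N, (size b <= j)%N
                          & x = iota a * X + iota b * Y].
Proof.
elim: j x => [|j IHj] x /=; last first.
  move=> /(step_eq0 (@espan_Flinear _ _ _ _))[c /IHj[a [b [sa sb xE]]]].
  exists a, (b + c%:P * 'X^j); split=> //.
    rewrite (leq_trans (size_polyD _ _)) // geq_max (leq_trans sb) //=.
    by rewrite mul_polyC (leq_trans (size_scale_leq _ _)) // size_polyXn.
  rewrite rmorphD rmorphM rmorphXn /= mulrDl addrA -xE -mulrA.
  by rewrite subrK.
elim: i x => [|i IHi] x /=.
  by move->; exists 0, 0; rewrite size_poly0 !rmorph0 !mul0r addr0.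
move=> /(step_eq0 (@espan_Flinear X Y i 0))[c /IHi[a [b [sa sb xE]]]].
exists (a + c%:P * 'X^i), b; split=> //.
  rewrite (leq_trans (size_polyD _ _)) // geq_max (leq_trans sa) //=.
  by rewrite mul_polyC (leq_trans (size_scale_leq _ _)) // size_polyXn.
rewrite rmorphD rmorphM rmorphXn /= mulrDl addrAC -xE -mulrA.
by rewrite subrK.
Qed.

(** For m < j the vector T^m (Y + c T^d X) differs from T^m Y by a multiple of T^(m+d) X, which is
    already a zero because m + d < i. *)
Lemma espan_shift X Y i j c d : (j + d <= i)%N ->
  espan X (Y + k c * T ^+ d * X) i j =1 espan X Y i j.
Proof.
elim: j => [|j IHj] ji x //=.
rewrite (step_ext _ (IHj _)) 1?ltnW //.
rewrite /step mulrDr -!mulrA mulrCA (espan_Flinear X Y i j).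
by rewrite mulrA -exprD espan_root1 // mulr0 addr0.
Qed.

Lemma dspan_shift X Y i j c d : (j + d <= i)%N ->
  dspan X (Y + k c * T ^+ d * X) i j = dspan X Y i j.
Proof.
elim: j => [|j IHj] ji //=.
rewrite IHj 1?ltnW // espan_shift 1?ltnW //.
rewrite mulrDr -!mulrA mulrCA (espan_Flinear X Y i j).
by rewrite mulrA -exprD espan_root1 // mulr0 addr0.
Qed.

(** * Behaviour under multiplication by T *)

(** The form is explained by generic [X]: the left side minus the first term on the right is
    F-linear of degree at most q^i and vanishes at the T^m X with m < i, so it is a multiple of
    [espan1 X i]; the coefficients of degree 1 give the factor. *)
Lemma espan1_mulT X i x :
  espan1 X i.+1 (T * x) = T ^+ (r.+1 ^ i.+1) * espan1 X i.+1 x +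
    (T ^+ (r.+1 ^ i.+1) - T) * espan1 X i (T ^+ i * X) ^+ r * espan1 X i x.
Proof.
elim: i x => [|i IHi] x.
  by rewrite /= /step /= expr0 mul1r expn1 !exprMn; ring.
(* At T^i X the induction hypothesis computes the next leading value [w]. *)
have := IHi (T ^+ i * X).
rewrite (espan_root1 X 0 0 (ltnSn i) : espan1 X i.+1 (T ^+ i * X) = 0).
rewrite mulr0 add0r mulrA -exprS => wE.
set xi := espan1 X i (T ^+ i * X) in IHi wE.
have E1 z : espan1 X i.+1 z = espan1 X i z ^+ r.+1 - xi ^+ r * espan1 X i z by [].
set w := espan1 X i.+1 (T ^+ i.+1 * X) in wE *.
have E2 z : espan1 X i.+2 z = espan1 X i.+1 z ^+ r.+1 - w ^+ r * espan1 X i.+1 z by [].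
have tauE : T ^+ (r.+1 ^ i.+2) = T ^+ (r.+1 ^ i.+1) ^+ r.+1.
  by rewrite -exprM -expnSr.
rewrite !E2 IHi tauE {}wE; move: (T ^+ _) (espan1 X i x) (E1 x) => tau u ->.
rewrite !(frobD, frobN, exprMn).
have sE : tau ^+ r.+1 = T ^+ r.+1 + (tau - T) * (tau - T) ^+ r.
  by rewrite -exprS frobB subrKC.
rewrite sE [(xi ^+ r) ^+ r.+1]exprS.
ring.
Qed.

(** The same count of degree and zeros leaves a combination of the q-th power of [espan X Y i j] and
    of [espan X Y i j] itself, the latter coefficient being read off in degree 1. The coefficient
    [al] stays unspecified because it cancels in the recursion for [ball_sum]. *)
Definition mulT_rel (X Y : L) (i j : nat) := exists al, forall x,
  espan X Y i.+1 j.+1 (T * x) =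
    T ^+ (r.+1 ^ (i + j).+2) * espan X Y i.+1 j.+1 x
    + al * espan X Y i j x ^+ r.+1
    + (T - T ^+ (r.+1 ^ (i + j).+2))
      * moore2 (espan X Y i j (T ^+ i * X)) (espan X Y i j (T ^+ j * Y)) ^+ r
      * espan X Y i j x.

Lemma mulT_rel_sym X Y i j : mulT_rel X Y i j -> mulT_rel Y X j i.
Proof.
move=> [al H]; exists al => x.
by rewrite !(espan_sym Y X) addnC H moore2_sym exprN_even.
Qed.

Lemma mulT_rel00 X Y : mulT_rel X Y 0 0.
Proof.
pose b := (Y ^+ r.+1 - X ^+ r * Y) ^+ r.
exists ((T ^+ (r.+1 ^ 2) - T ^+ r.+1) * (b + X ^+ r ^+ r.+1)) => x.
rewrite /= /step /= expr0 !mul1r moore2E [(X * _) ^+ r]exprMn -/b.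
rewrite !(frobD, frobN, exprMn) -mulnn exprM.
by ring.
Qed.

Lemma mulT_relS X Y i j : mulT_rel X Y i j -> mulT_rel X Y i.+1 j.
Proof.
move=> [al H].
have := H (T ^+ i * X).
rewrite espan_root1 // mulr0 add0r mulrA -exprS.
set y := T ^+ i.+1 * X; set w := espan X Y i.+1 j.+1 y => wE.
pose E0 := espan X Y i j; pose E1 := espan X Y i.+1 j.
set xi := espan X Y i j (T ^+ i * X) in H wE.
pose om := E1 (T ^+ j * Y).
have E1E z : E1 z = E0 z ^+ r.+1 - xi ^+ r * E0 z by exact: espan_stepX.
have E2E z : espan X Y i.+1 j.+1 z = E1 z ^+ r.+1 - om ^+ r * E1 z by [].
have E3E z : espan X Y i.+2 j.+1 z =
    espan X Y i.+1 j.+1 z ^+ r.+1 - w ^+ r * espan X Y i.+1 j.+1 z.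
  exact: espan_stepX.
have mE : moore2 xi (E0 (T ^+ j * Y)) ^+ r = xi ^+ r * om ^+ r.
  by rewrite moore2_step exprMn /om /E1 espan_stepX.
have m'E : moore2 (E1 y) om ^+ r = w ^+ r * om ^+ r.
  by rewrite moore2_sym moore2_step exprN_even exprMn mulrC.
have tauE : T ^+ (r.+1 ^ (i.+1 + j).+2) = T ^+ (r.+1 ^ (i + j).+2) ^+ r.+1.
  by rewrite -exprM -expnSr.
rewrite mE -/(E0 _) -/xi in H wE.
move: H wE; set tau := T ^+ _ => H wE.
(* [al ^+ r.+1] comes from the q-th power of the hypothesis; the other summand corrects the factor
   [tau] of the part multiplied by [w ^+ r] to [tau ^+ r.+1]. *)
exists (w ^+ r * (tau ^+ r.+1 - tau) + al ^+ r.+1) => x.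
rewrite -/(E1 y) -/om m'E tauE !E3E H -/tau -/(E0 x) !E2E -/(E1 x) !E1E.
move: (E0 x) => u.
pose g := al * xi ^+ r + (T - tau) * xi ^+ r * om ^+ r.
have -> : w ^+ r = xi ^+ r * g ^+ r.
  by rewrite -exprMn; congr (_ ^+ r); rewrite wE exprS /g; ring.
(* This is the expansion of [g ^+ r.+1]; added with the factor [u ^+ r.+1], it turns the goal into a
   ring identity. *)
have gE : al ^+ r.+1 * (xi ^+ r) ^+ r.+1
    + (T ^+ r.+1 - tau ^+ r.+1) * (xi ^+ r) ^+ r.+1 * (om ^+ r) ^+ r.+1
    - g * g ^+ r = 0.
  by rewrite -[g * _]exprS /g !(frobD, frobN, exprMn) subrr.
rewrite !(frobD, frobN, exprMn) -[RHS]addr0 -[X in _ = _ + X](mulr0 (u ^+ r.+1)) -{}gE.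
rewrite /g; move: (_ ^+ r) => G.
by ring.
Qed.

Lemma espan_mulT X Y i j : mulT_rel X Y i j.
Proof.
elim: j => [|j IHj]; last exact/mulT_rel_sym/mulT_relS/mulT_rel_sym.
by elim: i => [|i IHi]; [apply: mulT_rel00 | apply: mulT_relS].
Qed.

(** * The closed form and its recursion over the neighbours *)

Fixpoint ball_const (n : nat) : L :=
  if n is n'.+1 then ball_const n' * (T - T ^+ (r.+1 ^ n)) ^+ r.+1 else 1.

Definition ball_sum (X Y : L) (i j : nat) : L :=
  ball_const (i + j) * dspan X Y i j ^+ r.+2 /
  moore2 (espan X Y i j (T ^+ i * X)) (espan X Y i j (T ^+ j * Y)).

Definition independent (X Y : L) := forall a b : {poly F},
  iota a * X + iota b * Y = 0 -> a = 0 /\ b = 0.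

Lemma independent_sym X Y : independent X Y -> independent Y X.
Proof. by move=> XY a b; rewrite addrC => /XY[]. Qed.

Lemma independent_shift X Y a : independent X Y -> independent X (Y + iota a * X).
Proof.
move=> XY b c bc; have [] := XY (b + c * a) c.
  by rewrite rmorphD rmorphM /= -bc; ring.
by move=> + c0; rewrite c0 mul0r addr0.
Qed.

Lemma espan_neq0 X Y i j (a b : {poly F}) : independent X Y ->
  (i < size a)%N || (j < size b)%N -> espan X Y i j (iota a * X + iota b * Y) != 0.
Proof.
move=> XY sab; apply/eqP => /espan_eq0[a' [b' [sa sb /eqP]]].
rewrite -subr_eq0 opprD addrACA -!mulrBl -!rmorphB => /eqP/XY[/eqP + /eqP].
by rewrite !subr_eq0 => /eqP aE /eqP bE; move: sab; rewrite aE bE !ltnNge sa sb.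
Qed.

Lemma espan_lead_neq0 X Y i j : independent X Y -> espan X Y i j (T ^+ i * X) != 0.
Proof.
move=> XY; have := @espan_neq0 X Y i j 'X^i 0 XY.
by rewrite size_polyXn ltnSn rmorph0 rmorphXn mul0r addr0; apply.
Qed.

Lemma espan_line_neq0 X Y i j c : independent X Y ->
  espan X Y i j (T ^+ j * Y) + k c * espan X Y i j (T ^+ i * X) != 0.
Proof.
move=> XY; rewrite -espan_Flinear addrC mulrA.
have := @espan_neq0 X Y i j (c%:P * 'X^i) 'X^j XY.
by rewrite size_polyXn ltnSn orbT rmorphM !rmorphXn; apply.
Qed.

Lemma moore2_espan_neq0 X Y i j : independent X Y ->
  moore2 (espan X Y i j (T ^+ i * X)) (espan X Y i j (T ^+ j * Y)) != 0.
Proof.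
move=> XY; rewrite moore2_prod mulf_neq0 ?espan_lead_neq0 //.
by apply/prodf_neq0 => c _; exact: espan_line_neq0.
Qed.

Lemma exprN_even2 (x : L) : (- x) ^+ r.+2 = x ^+ r.+2.
Proof. by rewrite !exprS exprN_even; ring. Qed.

(** Up to a factor common to all neighbours, their closed forms are the values on the projective
    line of a quotient of linear forms: the numerators come from xi^(q^2) and eta^(q^2), the
    denominators from the leading values of [espan X Y i.+1 j.+1]. This is the point at infinity. *)
Lemma ball_sum_nbrX X Y i j (xi := espan X Y i j (T ^+ i * X))
    (m := moore2 xi (espan X Y i j (T ^+ j * Y))) : independent X Y ->
  ball_sum X Y i.+1 j = - (ball_const (i + j).+1 * dspan X Y i j ^+ r.+2 / m)
    * (xi ^+ r.+1 ^+ r.+1 / espan X Y i.+1 j.+1 (T ^+ i.+1 * X)).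
Proof.
move=> XY.
have xi0 : xi != 0 by exact: espan_lead_neq0.
have m0 : m != 0 by exact: moore2_espan_neq0.
have x0 := espan_lead_neq0 i.+1 j.+1 XY.
rewrite /ball_sum addSn dspan_stepX mulNr exprN_even2 exprMn -/xi.
rewrite moore2_sym moore2_step.
have mE : m = xi * espan X Y i.+1 j (T ^+ j * Y) by rewrite espan_stepX -moore2_step.
rewrite -/(espan X Y i.+1 j.+1 _).
have b0 : espan X Y i.+1 j (T ^+ j * Y) != 0.
  by apply: contraNneq m0 => b0; rewrite mE b0 mulr0.
rewrite mE; move: (espan X Y i.+1 j.+1 _) (espan X Y i.+1 j _) x0 b0 => x b x0 b0.
(* Here q^2 = 1 + (q - 1)(q + 1). *)
have -> : xi ^+ r.+1 ^+ r.+1 = xi * (xi ^+ r) ^+ r.+2.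
  by rewrite -!exprM -exprS; congr (_ ^+ _); lia.
by field; rewrite x0 b0 xi0 oppr_eq0 mulf_neq0.
Qed.

(** The finite points. The shift by c T^(i-j) X changes neither [espan] at (i, j) nor at (i+1, j+1),
    so only their leading values on [Y] change, by linearity. *)
Lemma ball_sum_nbrY X Y i j c (xi := espan X Y i j (T ^+ i * X))
    (eta := espan X Y i j (T ^+ j * Y)) (m := moore2 xi eta) :
    independent X Y -> (j <= i)%N ->
  ball_sum X (Y + k c * T ^+ (i - j) * X) i j.+1 =
    - (ball_const (i + j).+1 * dspan X Y i j ^+ r.+2 / m)
    * ((eta ^+ r.+1 ^+ r.+1 + k c * xi ^+ r.+1 ^+ r.+1)
       / (espan X Y i.+1 j.+1 (T ^+ j.+1 * Y)
          + k c * espan X Y i.+1 j.+1 (T ^+ i.+1 * X))).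
Proof.
move=> XY ji; set Y' := Y + _.
have TY n : T ^+ (j + n) * Y' = T ^+ (j + n) * Y + k c * (T ^+ (i + n) * X).
  rewrite /Y' mulrDr; congr (_ + _); rewrite -!mulrA mulrCA.
  by congr (_ * _); rewrite mulrA -exprD; congr (T ^+ _ * X); lia.
have TYj := TY 0; rewrite !addn0 in TYj.
have TYj1 := TY 1; rewrite !addn1 in TYj1.
have m0 : m != 0 by exact: moore2_espan_neq0.
have eta0 : eta + k c * xi != 0 by exact: espan_line_neq0.
have y0 := espan_line_neq0 i.+1 j.+1 c XY.
have E0 : espan X Y' i j =1 espan X Y i j by apply: espan_shift; lia.
have e1 : espan X Y' i j (T ^+ j * Y') = eta + k c * xi.
  by rewrite E0 TYj espan_Flinear.
have e2 : espan X Y' i.+1 j.+1 (T ^+ j.+1 * Y') =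
    espan X Y i.+1 j.+1 (T ^+ j.+1 * Y) + k c * espan X Y i.+1 j.+1 (T ^+ i.+1 * X).
  by rewrite espan_shift ?TYj1 ?espan_Flinear //; lia.
have mE : (eta + k c * xi) * espan X Y' i j.+1 (T ^+ i * X) = - m.
  rewrite -e1 -moore2_step e1 E0 -/xi /moore2 /m /moore2.
  by rewrite frobD exprMn frob_const; ring.
have dE : dspan X Y' i j.+1 = - (eta + k c * xi) ^+ r * dspan X Y i j.
  by rewrite -e1 -(@dspan_shift X Y i j c (i - j)) //; lia.
rewrite /ball_sum addnS dE moore2_step -(espan_stepX X Y' i j.+1) e2.
rewrite mulNr exprN_even2 exprMn.
have -> : eta ^+ r.+1 ^+ r.+1 + k c * xi ^+ r.+1 ^+ r.+1 =
    (eta + k c * xi) * ((eta + k c * xi) ^+ r) ^+ r.+2.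
  rewrite -[k c in LHS]frob_const -[k c in LHS]frob_const -!exprMn -!frobD.
  by rewrite -!exprM -exprS; congr (_ ^+ _); lia.
have {mE} -> : m = - ((eta + k c * xi) * espan X Y' i j.+1 (T ^+ i * X)).
  by rewrite mE opprK.
have b0 : espan X Y' i j.+1 (T ^+ i * X) != 0.
  by apply/espan_lead_neq0; rewrite /Y' -rmorphXn -rmorphM; apply: independent_shift.
move: (espan X Y' i j.+1 _) (eta + _) b0 eta0 => b h b0 h0.
move: (espan X Y i.+1 j.+1 _ + _) y0 => y y0.
by field; rewrite y0 b0 oppr_eq0 mulf_neq0.
Qed.

(** [psum_line_mobius] adds up the neighbours, and the resulting numerator is evaluated by the
    relation [mulT_rel] at T^i X and T^j Y. *)
Lemma ball_sum_recur X Y i j n : independent X Y -> (j <= i)%N -> (0 < n <= r)%N ->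
  ball_sum X Y i.+1 j.+1 ^+ n = ball_sum X Y i.+1 j ^+ n
    + \sum_c ball_sum X (Y + k c * T ^+ (i - j) * X) i j.+1 ^+ n.
Proof.
move=> XY ji nr.
rewrite (@ball_sum_nbrX X Y i j) // [in RHS]exprMn; under eq_bigr do rewrite ball_sum_nbrY // exprMn.
rewrite -mulr_sumr -mulrDr psum_line_mobius //; last 2 first.
- exact: espan_lead_neq0.
- by move=> c; exact: espan_line_neq0.
rewrite -exprMn; congr (_ ^+ n); rewrite /ball_sum.
have [al H] := espan_mulT X Y i j.
have xE := H (T ^+ i * X); have yE := H (T ^+ j * Y).
rewrite (espan_root1 X Y j.+1 (ltnSn i)) mulr0 add0r mulrA -exprS in xE.
rewrite (espan_root2 X Y i.+1 (ltnSn j)) mulr0 add0r mulrA -exprS in yE.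
have m0 := moore2_espan_neq0 i j XY.
have M0 := moore2_espan_neq0 i.+1 j.+1 XY.
have -> : dspan X Y i.+1 j.+1 =
    moore2 (espan X Y i j (T ^+ i * X)) (espan X Y i j (T ^+ j * Y)) ^+ r * dspan X Y i j.
  by rewrite moore2_step exprMn -espan_stepX [LHS]/= dspan_stepX; ring.
move: (espan X Y i j (T ^+ i * X)) (espan X Y i j (T ^+ j * Y)) xE yE m0 => xi eta xE yE m0.
move: (espan X Y _ _ (T ^+ i.+1 * X)) (espan X Y _ _ (T ^+ j.+1 * Y)) xE yE M0.
move=> x y xE yE M0.
(* The left side is the q-th power of xi^q y - eta^q x, in which the terms with [al] cancel. *)
have -> : xi ^+ r.+1 ^+ r.+1 * y ^+ r.+1 - eta ^+ r.+1 ^+ r.+1 * x ^+ r.+1 =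
   - (moore2 xi eta * (T - T ^+ (r.+1 ^ (i + j).+2)) * moore2 xi eta ^+ r) ^+ r.+1.
  by rewrite xE yE !(frobD, frobN, exprMn); ring.
rewrite addSn addnS -[ball_const _.+2]/(ball_const (i + j).+1 * (T - T ^+ _) ^+ r.+1).
move: (T - _) (ball_const _) (dspan _ _ _ _) => t C D.
have -> : (moore2 xi eta * t * moore2 xi eta ^+ r) ^+ r.+1 =
   moore2 xi eta * t ^+ r.+1 * (moore2 xi eta ^+ r) ^+ r.+2.
  move: (moore2 xi eta) => M; rewrite !exprMn [M ^+ r.+1]exprS.
  by rewrite [_ ^+ r.+2]exprS; ring.
rewrite [(_ * D) ^+ _]exprMn; move: (_ ^+ r.+2) (D ^+ _) (t ^+ _) => a b c.
by field; rewrite m0 M0.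
Qed.

(** When the second index is 0, the neighbour at infinity contains no basis. The numerator forms are
    therefore [lx = 0] and [ly = 1], and the positive power of [lx / x] disappears. *)
Lemma ball_sum_recur0 X Y i n : independent X Y -> (0 < n <= r)%N ->
  ball_sum X Y i.+1 0 ^+ n = \sum_c ball_sum X (Y + k c * T ^+ i.+1 * X) i 0 ^+ n.
Proof.
move=> XY nr.
pose xi := espan1 X i (T ^+ i * X); pose C := ball_const i.
have xi0 : xi != 0 by exact: (espan_lead_neq0 i 0 XY).
have bE c : ball_sum X (Y + k c * T ^+ i.+1 * X) i 0 = (C * dspan1 X i ^+ r.+2 / xi) *
   ((1 + k c * 0) / (espan X Y i.+1 0 (T ^+ 0 * Y) + k c * espan X Y i.+1 0 (T ^+ i.+1 * X))).
  rewrite -(espan_Flinear X Y i.+1 0) /ball_sum addn0 [espan _ _ _ _]/=.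
  rewrite moore2_step -/xi !mul1r mulr0 addr0 -mulrA.
  rewrite -[step _ _]/(espan X Y i.+1 0) invfM mulrA -[dspan _ _ _ _]/(dspan1 X i) /C [k c * (_ * X)]mulrA.
  by move: (espan _ _ _ _ _) (_ ^+ r.+2) => y a; ring.
under eq_bigr do rewrite bE exprMn.
rewrite -mulr_sumr.
have := @psum_line_mobius 0 1 _ _ n (espan_lead_neq0 i.+1 0 XY)
  (fun c => espan_line_neq0 i.+1 0 c XY) nr.
case/andP: nr => n0 _.
rewrite mul0r expr0n gtn_eqF // add0r => ->; rewrite -exprMn; congr (_ ^+ n).
rewrite mul0r mul1r sub0r /ball_sum !addn0.
have := espan1_mulT X i (T ^+ i * X).
rewrite (espan_root1 X 0 0 (ltnSn i) : espan1 X i.+1 _ = 0) mulr0 add0r mulrA -exprS.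
rewrite -/xi -mulrA -exprSr => xE.
have M0 := moore2_espan_neq0 i.+1 0 XY.
move: M0; rewrite -[espan X Y i.+1 0 (T ^+ i.+1 * X)]/(espan1 X i.+1 (T ^+ i.+1 * X)).
move: (espan1 X i.+1 _) (espan X Y i.+1 0 _) xE => x y xE M0.
rewrite [dspan _ _ _ _]/= -/xi mulNr exprN_even2 exprMn.
rewrite -[ball_const _.+1]/(ball_const i * (T - T ^+ _) ^+ r.+1).
have -> : x ^+ r.+1 = - ((T - T ^+ (r.+1 ^ i.+1)) ^+ r.+1 * (xi ^+ r.+1) ^+ r.+1).
  by rewrite xE -(opprB T) mulNr frobN exprMn.
rewrite opprK.
have -> : (xi ^+ r.+1) ^+ r.+1 = xi * (xi ^+ r) ^+ r.+2.
  by rewrite -!exprM -exprS; congr (_ ^+ _); lia.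
move: (T - _) (_ ^+ r.+2) => t a.
by rewrite -/C; field; rewrite M0 xi0.
Qed.
End FqLinear.

(** * Summation over Gamma(T) in a box *)

Lemma sum_I2 (V : nmodType) (f : 'I_2 -> V) : \sum_i f i = f 0 + f 1.
Proof. by rewrite !big_ord_recl big_ord0 addr0; congr (_ + f _); apply/val_inj. Qed.

Lemma I2P (P : 'I_2 -> Prop) : P 0 -> P 1 -> forall i, P i.
Proof.
by move=> P0 P1 [[|[|//]] i2]; [move: P0 | move: P1]; congr P; apply/val_inj.
Qed.

Lemma det2 (R : comNzRingType) (M : 'M[R]_2) :
  \det M = M 0 0 * M 1 1 - M 0 1 * M 1 0.
Proof.
rewrite (expand_det_row _ 0) sum_I2 /cofactor !det_mx11 !mxE.
rewrite /= expr0 mul1r expr1 mulN1r mulrN.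
by congr (_ * M _ _ - _ * M _ _); apply/val_inj.
Qed.

(** * Gamma(T) by determinant and evaluation at 0 *)

Section GammaT.
Variable F : finFieldType.

Lemma in_qpolyX_eq (f g : {poly F}) :
  (in_qpoly 'X f == in_qpoly 'X g) = (f.[0] == g.[0]).
Proof.
rewrite -val_eqE /= mk_monic_X -!(Pdiv.IdomainMonic.modpE (monicX F)).
rewrite -['X]subr0 -polyC0 !modp_XsubC.
by apply/eqP/eqP => [/polyC_inj|->].
Qed.

Lemma in_qpolyX_bool (f : {poly F}) (b : bool) :
  (in_qpoly 'X f == b%:R) = (f.[0] == b%:R).
Proof.
case: b; rewrite /= ?mulr1n ?mulr0n.
  by rewrite -(in_qpoly1 'X) in_qpolyX_eq hornerC.
by rewrite -(in_qpoly0 'X) in_qpolyX_eq hornerC.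
Qed.

Lemma poly_det_unit (g : 'M[{poly F}]_2) : g \in unitmx ->
  exists2 c, c != 0 & \det g = c%:P.
Proof. by rewrite unitmxE poly_unitE => /andP[/size_poly1P]. Qed.

Lemma horner0_det (g : 'M[{poly F}]_2) :
  (\det g).[0] = (g 0 0).[0] * (g 1 1).[0] - (g 0 1).[0] * (g 1 0).[0].
Proof. by rewrite det2 !hornerE. Qed.

(** Reduction modulo T is evaluation at 0. The determinant is a constant, and its value at 0 is
    1. *)
Lemma GammaT_P (g : 'M[{poly F}]_2) :
  reflect (\det g = 1 /\ forall a b, (g a b).[0] = (a == b)%:R)
    ((g \in unitmx) && (map_mx (in_qpoly 'X) g == 1%:M)).
Proof.
apply: (iffP andP) => [[gU /eqP g1]|[g1 g0]].
  have g0 a b : (g a b).[0] = (a == b)%:R.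
    have /eqP := congr1 (fun M : 'M_2 => M a b) g1; rewrite !mxE.
    by rewrite in_qpolyX_bool => /eqP.
  split=> //; have [c c0 dE] := poly_det_unit gU.
  have := horner0_det g; rewrite dE !g0 hornerC /= mulr1 mulr0 subr0 => ->.
  by rewrite polyC1.
split; first by rewrite unitmxE g1 unitr1.
apply/eqP/matrixP => a b; rewrite !mxE; apply/eqP.
by rewrite in_qpolyX_bool g0.
Qed.

Lemma GammaT_det (g : GammaT F) : \det (val g) = 1.
Proof. by have /GammaT_P[] := valP g. Qed.

Lemma GammaT_horner0 (g : GammaT F) a b : (val g a b).[0] = (a == b)%:R.
Proof. by have /GammaT_P[_] := valP g. Qed.
End GammaT.

(** Each column holds the coordinates of a lattice vector on a basis X, Y, so the rows bound the
    degrees of the coefficients of X and of Y. *)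
Definition in_box (F : finFieldType) (M : 'M[{poly F}]_2) (s t : nat) :=
  [forall c, (size (M 0%R c) <= s)%N && (size (M 1%R c) <= t)%N].

(** Coordinates transform in this way when Y is replaced by Y + f X. *)
Definition shear (R : nzRingType) (f : R) : 'M[R]_2 :=
  1%:M - f *: delta_mx 0 1.

Definition swap (R : nzRingType) : 'M[R]_2 := delta_mx 0 1 + delta_mx 1 0.

Section Rows.
Variables (R : comNzRingType) (f : R) (M : 'M[R]_2).

Lemma shear_row0 c : (shear f *m M) 0 c = M 0 c - f * M 1 c.
Proof. by rewrite mxE sum_I2 !mxE /= !(mulr1n, mulr0n, mulr0, mulr1, subr0, sub0r, mul1r) mulNr. Qed.

Lemma shear_row1 c : (shear f *m M) 1 c = M 1 c.
Proof. by rewrite mxE sum_I2 !mxE /= !(mulr1n, mulr0n, mulr0, mulr1, subr0, oppr0, mul1r, mul0r, addr0, add0r). Qed.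

Lemma swap_row0 c : (swap R *m M) 0 c = M 1 c.
Proof. by rewrite mxE sum_I2 !mxE /= !(mulr1n, mulr0n, addr0, add0r, mul1r, mul0r). Qed.

Lemma swap_row1 c : (swap R *m M) 1 c = M 0 c.
Proof. by rewrite mxE sum_I2 !mxE /= !(mulr1n, mulr0n, addr0, add0r, mul1r, mul0r). Qed.

Lemma shear_det : \det (shear f *m M) = \det M.
Proof. by rewrite !det2 !shear_row0 !shear_row1; ring. Qed.

Lemma swap_det : \det (swap R *m M) = - \det M.
Proof. by rewrite !det2 !swap_row0 !swap_row1; ring. Qed.
End Rows.

(** * Sums over the bases in a box *)

Section BallSum.
Variables (F : finFieldType) (L : fieldType) (iota : {rmorphism {poly F} -> L}).
Variables (p e : nat).
Hypotheses (p_pr : prime p) (card_F : #|F| = (p ^ e)%N) (q_odd : odd #|F|).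
Local Notation r := #|F|.-1.
Local Notation k c := (iota c%:P).
Local Notation T := (iota 'X).

Lemma size_leS_coef (f : {poly F}) n : (size f <= n.+1)%N ->
  (size f <= n)%N = (f`_n == 0).
Proof.
move=> fn; apply/idP/eqP => [/leq_sizeP->//|f0].
by apply/leq_sizeP => m; rewrite leq_eqVlt => /predU1P[<-//|/(leq_sizeP _ _ fn)].
Qed.

Lemma coefM_top (f g : {poly F}) m n : (size f <= m.+1)%N -> (size g <= n.+1)%N ->
  (f * g)`_(m + n) = f`_m * g`_n.
Proof.
move=> fm gn; rewrite coefM.
have mi : (m < (m + n).+1)%N by lia.
rewrite (bigD1 (Ordinal mi)) //= addKn big1 ?addr0 // => i.
rewrite -val_eqE /= neq_ltn => /orP[im|mi'].
  by rewrite [g`__]nth_default ?mulr0 // (leq_trans gn) //; lia.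
by rewrite nth_default ?mul0r // (leq_trans fm).
Qed.

Lemma coefXn_top (f : {poly F}) (c : F) m l : (l <= m)%N ->
  (c%:P * 'X^(m - l) * f)`_m = c * f`_l.
Proof. by move=> lm; rewrite -mulrA coefCM coefXnM ltnNge leq_subr /= subKn. Qed.

Lemma size_shear_term m l c (f : {poly F}) : (l <= m.+1)%N -> (size f <= l.+1)%N ->
  (size (c%:P * 'X^(m.+1 - l) * f)%R <= m.+2)%N.
Proof.
move=> lm fl; rewrite -mulrA mul_polyC (leq_trans (size_scale_leq _ _)) //.
by have := size_polyMleq 'X^(m.+1 - l) f; rewrite size_polyXn; lia.
Qed.

Lemma shear_box_sub m l c (M : 'M[{poly F}]_2) : (l <= m.+1)%N ->
  in_box (shear (c%:P * 'X^(m.+1 - l)) *m M) m.+1 l.+1 -> in_box M m.+2 l.+1.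
Proof.
move=> lm /forallP H; apply/forallP => b.
have /andP[] := H b; rewrite shear_row0 shear_row1 => s0 s1; rewrite s1 andbT.
rewrite -(subrK (c%:P * 'X^(m.+1 - l) * M 1 b) (M 0 b)).
by rewrite (leq_trans (size_polyD _ _)) // geq_max (leqW s0) size_shear_term.
Qed.

(* The leading coefficients of the two rows are proportional; they lie on all
   [q + 1] lines of [F^2] when they vanish, and on exactly one otherwise. *)
Lemma box_neighbours (M : 'M[{poly F}]_2) d m l :
    d != 0 -> \det M = d%:P -> (l <= m.+1)%N ->
  (in_box M m.+2 l.+1)%:R = (in_box M m.+2 l)%:R
    + \sum_(c : F) (in_box (shear (c%:P * 'X^(m.+1 - l)) *m M) m.+1 l.+1)%:R :> L.
Proof.
move=> d0 dM lm.
have shearP c : in_box (shear (c%:P * 'X^(m.+1 - l)) *m M) m.+1 l.+1 =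
  in_box M m.+2 l.+1 && [forall b, (M 0 b)`_m.+1 == c * (M 1 b)`_l].
  have sub_box := shear_box_sub lm.
  apply/idP/andP => [H|[/forallP H /forallP H']].
    split; first exact: sub_box H.
    apply/forallP => b; have := forallP (sub_box _ _ H) b.
    move: H => /forallP/(_ b); rewrite shear_row0 shear_row1 => /andP[s0 s1] /andP[s0' _].
    rewrite -subr_eq0 -(coefXn_top _ _ lm) -coefB -size_leS_coef //.
    by rewrite (leq_trans s0).
  apply/forallP => b; have /andP[s0 s1] := H b; rewrite shear_row0 shear_row1 s1 andbT.
  rewrite size_leS_coef; first by rewrite coefB coefXn_top // subr_eq0 H'.
  by rewrite (leq_trans (size_polyD _ _)) // geq_max size_polyN s0 size_shear_term.
have nbrP : in_box M m.+2 l = in_box M m.+2 l.+1 && [forall b, (M 1 b)`_l == 0].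
  apply/idP/andP => [/forallP H|[/forallP H /forallP H']]; last first.
    apply/forallP => b; have /andP[s0 s1] := H b.
    by rewrite s0 size_leS_coef ?H'.
  split; apply/forallP => b; have /andP[s0 s1] := H b.
    by rewrite s0 leqW.
  by rewrite -size_leS_coef // leqW.
rewrite nbrP; under eq_bigr do rewrite shearP.
have [/forallP box|_] := boolP (in_box M m.+2 l.+1); last by rewrite /= big1 ?addr0.
(* The constant [\det M] has no coefficient of degree [m.+1 + l]. *)
have lead : (M 0 0)`_m.+1 * (M 1 1)`_l = (M 0 1)`_m.+1 * (M 1 0)`_l.
  have /andP[s00 s10] := box 0; have /andP[s01 s11] := box 1.
  apply/eqP; rewrite -subr_eq0 -!coefM_top // -coefB -det2 dM coefC.
  by rewrite addSn.
(* If the second row has no leading coefficients, the condition is the same for all [c], so the sum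
   over [c] is a multiple of q = 0. *)
rewrite /=; have [/forallP b0|/forallPn[b b0]] := boolP [forall b, (M 1 b)`_l == 0].
  under eq_bigr => c _ do under eq_forallb => b do rewrite (eqP (b0 b)) mulr0.
  rewrite sumr_const card_F -card_F -[_ *+ #|F|]mulr_natr.
  by rewrite (card_natr0 iota p_pr card_F) mulr0 addr0.
rewrite add0r; pose c := (M 0 b)`_m.+1 / (M 1 b)`_l.
rewrite (bigD1 c) //= big1 ?addr0 => [|c' c'c]; last first.
  suff /negbTE -> : ~~ [forall b', (M 0 b')`_m.+1 == c' * (M 1 b')`_l] by [].
  apply/forallPn; exists b.
  by apply: contraNneq c'c => cE; rewrite /c cE mulfK.
suff -> : [forall b', (M 0 b')`_m.+1 == c * (M 1 b')`_l] by [].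
apply/forallP => b'; apply/eqP/(mulIf b0); rewrite mulrAC divfK //.
by move: b b' lead {c b0}; apply: I2P; apply: I2P => // ->.
Qed.

Definition latX (z : L) (g : 'M[{poly F}]_2) := iota (g 1 0) * z - iota (g 0 0).
Definition latY (z : L) (g : 'M[{poly F}]_2) := iota (g 1 1) * z - iota (g 0 1).

Section Basis.
Variables (z : L) (H : 'M[{poly F}]_2) (X Y : L).
Hypothesis X1 : - 1 = iota (H 0 0) * X + iota (H 1 0) * Y.
Hypothesis zE : z = iota (H 0 1) * X + iota (H 1 1) * Y.

(** The columns of [H] are the coordinates of -1 and [z] on [X], [Y]; those of [H *m g] are then the
    coordinates of [latX z g] and [latY z g]. *)
Lemma latX_basis g :
  latX z g = iota ((H *m g) 0 0) * X + iota ((H *m g) 1 0) * Y.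
Proof.
rewrite /latX -[iota (g 0 0)]mul1r -mulNr X1 {1}zE !mxE !sum_I2 !rmorphD !rmorphM /=.
by ring.
Qed.

Lemma latY_basis g :
  latY z g = iota ((H *m g) 0 1) * X + iota ((H *m g) 1 1) * Y.
Proof.
rewrite /latY -[iota (g 0 1)]mul1r -mulNr X1 {1}zE !mxE !sum_I2 !rmorphD !rmorphM /=.
by ring.
Qed.
End Basis.

Lemma moore2_lin (m : 'M[F]_2) (X Y : L) :
  moore2 F (k (m 0 0) * X + k (m 1 0) * Y) (k (m 0 1) * X + k (m 1 1) * Y)
  = k (\det m) * moore2 F X Y.
Proof.
rewrite /moore2 !(frobD iota p_pr card_F) !exprMn !(frob_const iota).
by rewrite det2 polyCB !polyCM rmorphB !rmorphM /=; ring.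
Qed.

Lemma const_box (M : 'M[{poly F}]_2) :
  in_box M 1 1 -> M = map_mx polyC (map_mx (horner_eval 0) M).
Proof.
move=> /forallP H; apply/matrixP => a b; rewrite !mxE /horner_eval.
have sM : (size (M a b) <= 1)%N.
  by have /andP[] := H b; move: a; apply: I2P.
by move: (M a b) sM => f /size1_polyC ->; rewrite hornerC.
Qed.

Lemma GammaT_eval0 (g : GammaT F) : map_mx (horner_eval 0) (val g) = 1%:M.
Proof. by apply/matrixP => a b; rewrite !mxE /horner_eval GammaT_horner0. Qed.

(** If [H *m g] is constant it equals its value at 0, which is that of [H] because [g] is 1 there.
    Conversely H^-1 H(0) lies in Gamma(T). *)
Lemma unit_box (H : 'M[{poly F}]_2) : H \in unitmx -> exists g0 : GammaT F,
  H *m val g0 = map_mx polyC (map_mx (horner_eval 0) H) /\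
  forall g : GammaT F, in_box (H *m val g) 1 1 = (g == g0).
Proof.
move=> HU; pose h := map_mx polyC (map_mx (horner_eval 0) H).
have evh : map_mx (horner_eval 0) h = map_mx (horner_eval 0) H.
  by apply/matrixP => a b; rewrite !mxE /horner_eval hornerC.
have [d d0 dH] := poly_det_unit HU.
have dH0 : \det (map_mx (horner_eval 0) H) = d.
  by rewrite det_map_mx dH /= /horner_eval hornerC.
have HU0 : map_mx (horner_eval 0) H \in unitmx by rewrite unitmxE dH0 unitfE.
have hG : (invmx H *m h \in unitmx) && (map_mx (in_qpoly 'X) (invmx H *m h) == 1%:M).
  apply/GammaT_P; split.
    rewrite det_mulmx det_inv det_map_mx dH0 dH mulVr //.
    by rewrite poly_unitE size_polyC d0 coefC unitfE.
  move=> a b; suff /(congr1 (fun M : 'M_2 => M a b)) :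
    map_mx (horner_eval 0) (invmx H *m h) = 1%:M by rewrite !mxE.
  by rewrite map_mxM evh -map_mxM mulVmx // map_mx1.
exists (Sub (invmx H *m h) hG : GammaT F); rewrite /= mulKVmx //; split=> // g.
apply/idP/eqP => [/const_box Hg|->].
  apply/val_inj => /=; rewrite -[val g](mulKmx HU) Hg map_mxM GammaT_eval0.
  by rewrite mulmx1.
apply/forallP => b; rewrite /= mulKVmx // !mxE !size_polyC.
by rewrite !leq_b1.
Qed.

Lemma ball_sum_sym X Y i j : ball_sum iota Y X j i = - ball_sum iota X Y i j.
Proof.
rewrite /ball_sum addnC (dspan_sym iota p_pr card_F q_odd Y X).
rewrite !(espan_sym iota p_pr card_F q_odd Y X) moore2_sym invrN mulrN.
by [].
Qed.

(** Induction on [i + j]: [box_neighbours] splits the sum and the recursions for [ball_sum]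
    reassemble it. [S] is any finite set containing all relevant elements, so that it can stay
    fixed. The factor [d] arises at [i = j = 0], where a constant base change of determinant [d]
    multiplies the Moore determinant by [d]. *)
Lemma ball_sum_GammaT (z : L) n i j (H : 'M[{poly F}]_2) X Y d (S : seq (GammaT F)) :
    (0 < n <= r)%N -> d != 0 -> \det H = d%:P ->
    - 1 = iota (H 0 0) * X + iota (H 1 0) * Y ->
    z = iota (H 0 1) * X + iota (H 1 1) * Y ->
    independent iota X Y -> uniq S ->
    (forall g : GammaT F, in_box (H *m val g) i.+1 j.+1 -> g \in S) ->
  \sum_(g <- S | in_box (H *m val g) i.+1 j.+1)
     moore2 F (latX z (val g)) (latY z (val g)) ^- n =
  (ball_sum iota X Y i j / k d) ^+ n.
Proof.
move=> nr; move En: (i + j)%N => N.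
elim: N => [|N IHN] in i j En H X Y d S *.
  have [-> ->] : i = 0%N /\ j = 0%N by lia.
  move=> d0 dH X1 zE XY uS inS.
  have HU : H \in unitmx by rewrite unitmxE dH poly_unitE size_polyC d0 coefC unitfE.
  have [g0 [Hg0 g0P]] := unit_box HU.
  have g0S : g0 \in S by apply: inS; rewrite g0P.
  rewrite (eq_bigl _ _ g0P) -big_filter filter_pred1_uniq // big_seq1.
  rewrite (latX_basis X1 zE) (latY_basis X1 zE).
  have dH0 : \det (map_mx (horner_eval 0) H) = d.
    by rewrite det_map_mx dH /= /horner_eval hornerC.
  have := moore2_lin (map_mx (horner_eval 0) H) X Y.
  rewrite dH0 Hg0 !mxE => ->.
  rewrite -exprVn; congr (_ ^+ n); rewrite /ball_sum /= expr1n mulr1 !expr0 !mul1r.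
  by rewrite invfM mulrC.
(* Exchanging [X] and [Y] changes the sign of both [ball_sum] and [d]. *)
wlog ji : i j En H X Y d S / (j <= i)%N => [IH|d0 dH X1 zE XY uS inS].
  have [/IH IH0|ij] := leqP j i; first exact: IH0.
  move=> d0 dH X1 zE XY uS inS.
  have boxE g : in_box (swap _ *m H *m g) j.+1 i.+1 = in_box (H *m g) i.+1 j.+1.
    by apply: eq_forallb => c; rewrite -mulmxA swap_row0 swap_row1 andbC.
  have := IH j i _ (swap _ *m H) Y X (- d) S (ltnW ij).
  rewrite addnC oppr_eq0 swap_det dH polyCN !swap_row0 !swap_row1.
  rewrite [_ * Y + _]addrC -X1 [_ * Y + _]addrC -zE.
  move=> /(_ En d0 erefl erefl erefl (independent_sym XY) uS).
  under eq_bigl do rewrite boxE.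
  move=> -> => [|g]; last by rewrite boxE; exact: inS.
  by rewrite ball_sum_sym rmorphN invrN mulrNN.
have [m iE] : exists m, i = m.+1 by exists i.-1; lia.
rewrite {}iE in En ji inS *.
pose x (g : GammaT F) := moore2 F (latX z (val g)) (latY z (val g)) ^- n.
pose Hs c := shear (c%:P * 'X^(m.+1 - j)) *m H.
have sumE : \sum_(g <- S | in_box (H *m val g) m.+2 j.+1) x g =
    \sum_(g <- S | in_box (H *m val g) m.+2 j) x g
    + \sum_c \sum_(g <- S | in_box (Hs c *m val g) m.+1 j.+1) x g.
  have mk P : \sum_(g <- S | P g) x g = \sum_(g <- S) x g * (P g)%:R.
    by rewrite big_mkcond; apply: eq_bigr => g _; rewrite mulr_natr mulrb.
  rewrite !mk; under [X in _ + X]eq_bigr do rewrite mk.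
  rewrite exchange_big -big_split; apply: eq_bigr => g _ /=.
  have dHg : \det (H *m val g) = d%:P by rewrite det_mulmx dH GammaT_det mulr1.
  rewrite (box_neighbours d0 dHg ji) mulrDr mulr_sumr; congr (_ + _).
  by apply: eq_bigr => c _; rewrite mulmxA.
rewrite {}sumE.
have sumY c : \sum_(g <- S | in_box (Hs c *m val g) m.+1 j.+1) x g =
    (ball_sum iota X (Y + k c * T ^+ (m.+1 - j) * X) m j / k d) ^+ n.
  have kE : k c * T ^+ (m.+1 - j) = iota (c%:P * 'X^(m.+1 - j)).
    by rewrite rmorphM rmorphXn.
  apply: IHN; rewrite ?kE //.
  - by lia.
  - by rewrite shear_det.
  - by rewrite /Hs shear_row0 shear_row1 X1 rmorphB rmorphM /=; ring.
  - by rewrite /Hs shear_row0 shear_row1 zE rmorphB rmorphM /=; ring.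
  - exact: independent_shift.
  by move=> g; rewrite -mulmxA => gB; apply/inS/(shear_box_sub ji gB).
under [X in _ + X]eq_bigr do rewrite sumY.
case: j => [|j] in En ji inS Hs sumY *.
  (* The box with second bound 0 forces a zero row, which the nonzero determinant excludes. *)
  rewrite big1 ?add0r => [|g /forallP gB]; last first.
    have row0 b : (H *m val g) 1 b = 0.
      by apply/eqP; rewrite -size_poly_leq0; case/andP: (gB b).
    have : \det (H *m val g) = 0 by rewrite det2 !row0 !mulr0 subr0.
    rewrite det_mulmx dH GammaT_det mulr1 => /eqP.
    by rewrite polyC_eq0 (negbTE d0).
  under eq_bigr do rewrite (expr_div_n (ball_sum _ _ _ _ _) (k d)).
  rewrite -mulr_suml (expr_div_n (ball_sum _ _ _ _ _) (k d)); congr (_ / _).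
  by rewrite (ball_sum_recur0 p_pr card_F q_odd m XY nr).
rewrite (IHN m.+1 j _ H X Y d S) //; last 2 first.
- by lia.
- move=> g /forallP gB; apply/inS/forallP => b.
  by have /andP[-> /leqW] := gB b.
rewrite !(expr_div_n (ball_sum _ _ _ _ _) (k d)).
under eq_bigr do rewrite (expr_div_n (ball_sum _ _ _ _ _) (k d)).
rewrite -mulr_suml -mulrDl; congr (_ / _).
by rewrite (ball_sum_recur p_pr card_F q_odd XY _ nr).
Qed.
End BallSum.

(** * Unordered sums in ultrametric fields *)

Section Ultrametric.
Variables (R : realType) (C : valuedField R).
Implicit Types (x y : C).

Definition nrm (x : C) : R := absv (x : valued_field C).

Lemma nrm_ge0 x : 0 <= nrm x. Proof. exact: absv_ge0. Qed.
Lemma nrm_eq0 x : (nrm x == 0) = (x == 0). Proof. exact: absv_eq0. Qed.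
Lemma nrm_gt0 x : (0 < nrm x) = (x != 0).
Proof. by rewrite lt0r nrm_ge0 andbT nrm_eq0. Qed.
Lemma nrm0 : nrm 0 = 0. Proof. by apply/eqP; rewrite nrm_eq0. Qed.
Lemma nrmM x y : nrm (x * y) = nrm x * nrm y. Proof. exact: absvM. Qed.
Lemma nrmN x : nrm (- x) = nrm x. Proof. exact: absvN. Qed.
Lemma nrmB x y : nrm (x - y) = nrm (y - x). Proof. by rewrite -nrmN opprB. Qed.

Lemma nrm1 : nrm 1 = 1.
Proof.
have n0 : nrm 1 != 0 by rewrite nrm_eq0 oner_neq0.
by apply: (mulfI n0); rewrite -nrmM !mulr1.
Qed.

Lemma nrmX x n : nrm (x ^+ n) = nrm x ^+ n.
Proof. by elim: n => [|n IHn]; rewrite ?expr0 ?nrm1 // !exprS nrmM IHn. Qed.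

Lemma nrmV x : nrm x^-1 = (nrm x)^-1.
Proof.
have [->|x0] := eqVneq x 0; first by rewrite invr0 nrm0 invr0.
have n0 : nrm x != 0 by rewrite nrm_eq0.
by apply: (mulfI n0); rewrite -nrmM !divff // nrm1.
Qed.

Lemma nrm_prod (I : Type) (s : seq I) (f : I -> C) :
  nrm (\prod_(i <- s) f i) = \prod_(i <- s) nrm (f i).
Proof. by apply: (big_morph nrm nrmM nrm1). Qed.

Lemma nrmD_le x y (eps : R) : nrm x <= eps -> nrm y <= eps -> nrm (x + y) <= eps.
Proof.
by move=> xe ye; apply: le_trans (absvD _ _) _; rewrite ge_max xe ye.
Qed.

Lemma nrmD_lt x y (eps : R) : nrm x < eps -> nrm y < eps -> nrm (x + y) < eps.
Proof.
by move=> xe ye; apply: le_lt_trans (absvD _ _) _; rewrite gt_max xe ye.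
Qed.

Lemma nrmB_le x y (eps : R) : nrm x <= eps -> nrm y <= eps -> nrm (x - y) <= eps.
Proof. by move=> xe ye; rewrite nrmD_le ?nrmN. Qed.

Lemma nrm_sum_le (I : Type) (s : seq I) (P : pred I) (f : I -> C) (eps : R) : 0 <= eps ->
  (forall i, P i -> nrm (f i) <= eps) -> nrm (\sum_(i <- s | P i) f i) <= eps.
Proof.
by move=> e0 fe; elim/big_ind: _ => // [|x y]; [rewrite nrm0 | apply: nrmD_le].
Qed.

Lemma nrm_dominant x y : nrm (x - y) < nrm y -> nrm x = nrm y.
Proof.
move=> xy; apply/eqP; rewrite eq_le; apply/andP; split.
  by rewrite -[x](subrK y) nrmD_le // ltW.
rewrite leNgt; apply/negP => yx.
have : nrm (x - (x - y)) < nrm y by apply: nrmD_lt; rewrite ?nrmN.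
by rewrite subKr ltxx.
Qed.

Local Existing Instance totally_filter.

Definition netlim (I : choiceType) (f : {fset I} -> C) (l : C) :=
  forall eps : R, 0 < eps ->
    exists S0 : {fset I}, forall S, (S0 `<=` S)%fset -> nrm (f S - l) <= eps.

Lemma netlim_lim (I : choiceType) (f : {fset I} -> C) (l : C) :
  netlim f l -> lim (f @ totally)%classic = l.
Proof.
move=> fl; apply: cvg_lim; first exact: metric_hausdorff.
apply/cvg_ballP => eps eps0.
have e2 : 0 < eps / 2 by rewrite divr_gt0.
have [S0 H] := fl _ e2; exists S0 => // S /= S0S.
rewrite ballEmdist /= /mdist /= /abs_dist -absvN opprB.
by apply: le_lt_trans (H S S0S) _; lra.
Qed.

Lemma net_cauchy (I : choiceType) (f : {fset I} -> C) :
  (forall G : set_system C, ProperFilter G -> cauchy G -> cvg G)%classic ->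
  (forall eps : R, 0 < eps -> exists S0 : {fset I}, forall S,
    (S0 `<=` S)%fset -> nrm (f S - f S0) <= eps) ->
  exists l, netlim f l.
Proof.
move=> Ccomp fC.
have cf : cvg (f @ totally)%classic.
  apply: Ccomp; apply: cauchy_exP => eps eps0.
  have e2 : 0 < eps / 2 by rewrite divr_gt0.
  have [S0 H] := fC _ e2; exists (f S0); exists S0 => // S /= S0S.
  rewrite ballEmdist /= /mdist /= /abs_dist -absvN opprB.
  by apply: le_lt_trans (H S S0S) _; lra.
exists (lim (f @ totally)%classic) => eps eps0.
move/cvg_ballP : cf => /(_ eps eps0)[S0 _ H]; exists S0 => S S0S.
have := H S S0S; rewrite /= ballEmdist /= /mdist /= /abs_dist => /ltW.
by rewrite -/(nrm _) nrmB.
Qed.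

Lemma netlim_uniq (I : choiceType) (f : {fset I} -> C) (l l' : C) :
  netlim f l -> netlim f l' -> l = l'.
Proof. by move=> /netlim_lim <- /netlim_lim <-. Qed.

Definition sums_to (I : choiceType) (x : I -> C) (l : C) :=
  netlim (fun S : {fset I} => \sum_(i <- S) x i) l.

Definition null_family (I : choiceType) (x : I -> C) := forall eps : R, 0 < eps ->
  exists S0 : {fset I}, forall i, i \notin S0 -> nrm (x i) <= eps.

Lemma usumE (I : choiceType) (x : I -> C) l : sums_to x l -> usum x = l.
Proof. exact: netlim_lim. Qed.

Lemma big_fsetD (T : Type) (idx : T) (op : Monoid.com_law idx) (I : choiceType)
    (x : I -> T) (S0 S : {fset I}) : (S0 `<=` S)%fset ->
  \big[op/idx]_(i <- S) x i =
  op (\big[op/idx]_(i <- S0) x i) (\big[op/idx]_(i <- (S `\` S0)%fset) x i).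
Proof.
move=> /fsubsetP S0S; rewrite -big_cat; apply: perm_big; apply: uniq_perm => //.
  rewrite cat_uniq !fset_uniq andbT /=; apply/hasPn => i.
  by rewrite in_fsetD => /andP[].
move=> i; rewrite mem_cat in_fsetD; have [iS0|//] := boolP (i \in S0).
by rewrite S0S.
Qed.

(** By the ultrametric inequality a finite sum of terms of size at most eps has size at most eps, so
    the partial sums are Cauchy. *)
Lemma null_sums_to (I : choiceType) (x : I -> C) :
  (forall G : set_system C, ProperFilter G -> cauchy G -> cvg G)%classic ->
  null_family x -> exists l, sums_to x l.
Proof.
move=> Ccomp x0; apply: net_cauchy => // eps eps0.
have [S0 H] := x0 _ eps0; exists S0 => S /(big_fsetD _ x) ->.
rewrite addrC addKr big_seq; apply: nrm_sum_le; first exact: ltW.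
by move=> i; rewrite in_fsetD => /andP[/H].
Qed.

(** Passing from [S] to a larger set whose sum is close to [l] only adds terms of size at most
    eps. *)
Lemma sums_to_dist (I : choiceType) (x : I -> C) l (S0 S : {fset I}) (eps : R) :
    0 < eps -> sums_to x l -> (forall i, i \notin S0 -> nrm (x i) <= eps) ->
  (S0 `<=` S)%fset -> nrm (\sum_(i <- S) x i - l) <= eps.
Proof.
move=> eps0 /(_ _ eps0)[S1 H1] H0 S0S.
have SS : (S `<=` S `|` S1)%fset by exact: fsubsetUl.
have := H1 (S `|` S1)%fset (fsubsetUr _ _).
rewrite (big_fsetD _ x SS) /= => H.
set s := \sum_(i <- S) _ in H *; set t := \sum_(i <- _) x i in H.
have -> : s - l = s + t - l - t by ring.
apply: nrmB_le => //; rewrite /t big_seq; apply: nrm_sum_le; first exact: ltW.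
move=> i; rewrite in_fsetD => /andP[iS _]; apply: H0; apply: contra iS.
exact: (fsubsetP S0S).
Qed.

(** The large terms lie in a finite rectangle with second side [J0]. Its partial sum is within eps
    of [l], and each of its row sums is within eps of [y i]. *)
Lemma sums_to_fubini (I J : choiceType) (x : I * J -> C) (y : I -> C) l :
    null_family x -> sums_to x l -> (forall i, sums_to (fun j => x (i, j)) (y i)) ->
  sums_to y l.
Proof.
move=> x0 xl xy eps eps0; have [S0 H0] := x0 _ eps0.
pose I0 := [fset p.1 | p in S0]%fset; pose J0 := [fset p.2 | p in S0]%fset.
exists I0 => S I0S.
pose P := [fset p in [seq (i, j) | i <- S, j <- J0]]%fset.
have sumP : \sum_(p <- P) x p = \sum_(i <- S) \sum_(j <- J0) x (i, j).
  rewrite -big_allpairs; apply: perm_big; apply: uniq_perm => //.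
    by apply: allpairs_uniq => // -[? ?] [? ?] _ _ [-> ->].
  by move=> p; rewrite !inE.
have -> : \sum_(i <- S) y i - l =
    (\sum_(p <- P) x p - l) - \sum_(i <- S) (\sum_(j <- J0) x (i, j) - y i).
  by rewrite sumP sumrB; ring.
apply: nrmB_le.
  apply: (sums_to_dist eps0 xl H0); apply/fsubsetP => -[i j] ijS.
  rewrite !inE /=; apply/allpairsP; exists (i, j); split=> //=.
    by apply: (fsubsetP I0S); apply/imfsetP; exists (i, j).
  by apply/imfsetP; exists (i, j).
apply: nrm_sum_le => [|i _]; first exact: ltW.
apply: (sums_to_dist eps0 (xy i) _ (fsubset_refl _)) => j jJ0.
by apply: H0; apply: contra jJ0 => ijS; apply/imfsetP; exists (i, j).
Qed.

Lemma sums_to_bij (I J : choiceType) (f : I -> J) (x : J -> C) l :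
  bijective f -> sums_to x l -> sums_to (x \o f) l.
Proof.
move=> [g fK gK] xl eps eps0; have [S0 H0] := xl _ eps0.
exists [fset g j | j in S0]%fset => S S0S.
have -> : \sum_(i <- S) (x \o f) i = \sum_(j <- [fset f i | i in S]%fset) x j.
  rewrite -(big_map f xpredT x); apply: perm_big; apply: uniq_perm => //.
    by rewrite map_inj_uniq //; exact: can_inj fK.
  by move=> j; apply/mapP/imfsetP => -[i iS ->]; exists i.
apply: H0; apply/fsubsetP => j jS0; apply/imfsetP; exists (g j) => //=.
by apply: (fsubsetP S0S); apply/imfsetP; exists j.
Qed.

Lemma null_family_bij (I J : choiceType) (f : I -> J) (x : J -> C) :
  bijective f -> null_family x -> null_family (x \o f).
Proof.
move=> [g fK gK] x0 eps eps0; have [S0 H0] := x0 _ eps0.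
exists [fset g j | j in S0]%fset => i iS0; apply: H0.
by apply: contra iS0 => fiS0; apply/imfsetP; exists (f i).
Qed.

Lemma null_familyX (I : choiceType) (x : I -> C) n : (0 < n)%N ->
  null_family x -> null_family (fun i => x i ^+ n).
Proof.
case: n => // n _ x0 eps eps0.
have m0 : 0 < Num.min eps 1 by rewrite lt_min eps0 ltr01.
have [S0 H0] := x0 _ m0; exists S0 => i /H0; rewrite le_min => /andP[h1 h2].
rewrite nrmX exprS -[eps]mulr1; apply: ler_pM => //; rewrite ?exprn_ge0 ?nrm_ge0 //.
by rewrite exprn_ile1 ?nrm_ge0.
Qed.

Lemma null_familyZ (I : choiceType) (x : I -> C) c :
  null_family x -> null_family (fun i => c * x i).
Proof.
move=> x0 eps eps0; have [->|c0] := eqVneq c 0.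
  by exists fset0 => i _; rewrite mul0r nrm0 ltW.
rewrite -nrm_gt0 in c0; have [S0 H0] := x0 _ (divr_gt0 eps0 c0).
by exists S0 => i /H0; rewrite nrmM ler_pdivlMr // mulrC.
Qed.

Lemma sums_toZ (I : choiceType) (x : I -> C) c l :
  sums_to x l -> sums_to (fun i => c * x i) (c * l).
Proof.
move=> xl eps eps0; have [->|c0] := eqVneq c 0.
  exists fset0 => S _; rewrite big1 => [|i _]; last by rewrite mul0r.
  by rewrite mul0r subr0 nrm0 ltW.
rewrite -nrm_gt0 in c0; have [S0 H0] := xl _ (divr_gt0 eps0 c0).
exists S0 => S /H0; rewrite -mulr_sumr -mulrBr nrmM ler_pdivlMr //.
by rewrite mulrC.
Qed.

Lemma sums_to_fin (I : finType) (x : I -> C) : sums_to x (\sum_i x i).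
Proof.
move=> eps eps0; exists [fset i in enum I]%fset => S IS.
suff -> : \sum_(i <- S) x i = \sum_i x i by rewrite subrr nrm0 ltW.
apply: perm_big; apply: uniq_perm => //; first exact: index_enum_uniq.
move=> i; rewrite mem_index_enum; apply: (fsubsetP IS).
by rewrite !inE mem_enum.
Qed.

(** * Limits along exhausting sequences of finite sets *)

Definition seqlim (a : nat -> C) (l : C) := forall eps : R, 0 < eps ->
  exists M, forall m, (M <= m)%N -> nrm (a m - l) <= eps.

Lemma nrm_small0 x : (forall eps : R, 0 < eps -> nrm x <= eps) -> x = 0.
Proof.
move=> H; apply/eqP; rewrite -nrm_eq0 eq_le nrm_ge0 andbT.
by apply/ler_addgt0Pl => eps /H; rewrite addr0.
Qed.

Lemma seqlim_uniq a l l' : seqlim a l -> seqlim a l' -> l = l'.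
Proof.
move=> al al'; apply/eqP; rewrite -subr_eq0; apply/eqP/nrm_small0 => eps eps0.
have [M H] := al _ eps0; have [M' H'] := al' _ eps0.
have -> : l - l' = (a (maxn M M') - l') - (a (maxn M M') - l) by ring.
by apply: nrmB_le; [apply: H'; rewrite leq_maxr | apply: H; rewrite leq_maxl].
Qed.

Lemma seqlimM a b l l' : seqlim a l -> seqlim b l' -> seqlim (fun m => a m * b m) (l * l').
Proof.
move=> al bl eps eps0.
pose B := Num.max 1 (Num.max (nrm l) (nrm l')).
have B1 : 1 <= B by rewrite le_max lexx.
have lB : nrm l <= B by rewrite !le_max lexx orbT.
have lB' : nrm l' <= B by rewrite !le_max lexx !orbT.
have B0 : 0 < B by apply: lt_le_trans B1.
have e0 : 0 < Num.min 1 (eps / B) by rewrite lt_min ltr01 divr_gt0.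
have [M H] := al _ e0; have [M' H'] := bl _ e0.
exists (maxn M M') => m; rewrite geq_max => /andP[/H am /H' bm].
move: am bm; rewrite !le_min => /andP[am1 am] /andP[bm1 bm].
have -> : a m * b m - l * l' = (a m - l) * b m + l * (b m - l') by ring.
have bB : nrm (b m) <= B by rewrite -[b m](subrK l'); apply: nrmD_le => //; exact: le_trans B1.
apply: nrmD_le; rewrite nrmM.
  by rewrite -(divfK (lt0r_neq0 B0) eps) ler_pM ?nrm_ge0.
by rewrite -(divfK (lt0r_neq0 B0) eps) mulrC ler_pM ?nrm_ge0.
Qed.

Lemma seqlimX a l n : seqlim a l -> seqlim (fun m => a m ^+ n) (l ^+ n).
Proof.
move=> al; elim: n => [|n IHn].
  by move=> eps eps0; exists 0%N => m _; rewrite !expr0 subrr nrm0 ltW.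
rewrite exprS; have := seqlimM al IHn.
by move=> H eps /H[M HM]; exists M => m /HM; rewrite exprS.
Qed.

Lemma netlim_seq (I : choiceType) (f : {fset I} -> C) l (S : nat -> {fset I}) :
    (forall i, exists M, forall m, (M <= m)%N -> i \in S m) ->
  netlim f l -> seqlim (fun m => f (S m)) l.
Proof.
move=> exh fl eps eps0; have [S0 H0] := fl _ eps0.
have [M HM] : exists M, forall m, (M <= m)%N -> {subset enum_fset S0 <= S m}.
  elim: (enum_fset S0) => [|i s [M HM]]; first by exists 0%N.
  have [M' HM'] := exh i; exists (maxn M M') => m; rewrite geq_max => /andP[Mm Mm'] j.
  by rewrite inE => /predU1P[->|js]; [apply: HM' | apply: HM].
by exists M => m Mm; apply: H0; apply/fsubsetP; apply: HM.
Qed.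
End Ultrametric.

(** * Absolute values of lattice elements *)

Section CinftyNorm.
Variables (R : realType) (F : finFieldType) (C : valuedField R).
Variable iota : {rmorphism {poly F} -> C}.
Hypothesis normT : nrm (iota 'X) = #|F|%:R :> R.
Local Notation q := (#|F|%:R : R).
Local Notation k c := (iota c%:P).
Local Notation T := (iota 'X).

Lemma card_gt1 : 1 < q.
Proof. by rewrite ltr1n finNzRing_gt1. Qed.

Lemma card_gt0 : 0 < q.
Proof. exact: lt_trans ltr01 card_gt1. Qed.

(** Nonzero constants are roots of unity of order dividing q - 1. *)
Lemma nrm_const c : c != 0 -> nrm (k c) = 1.
Proof.
move=> c0; have n0 : nrm (k c) != 0.
  by rewrite nrm_eq0 (iota_const_eq0 (L := C)).
have : nrm (k c) ^+ #|F|.-1 = 1.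
  apply: (mulfI n0); rewrite -exprS -nrmX mulr1.
  by rewrite (frob_const (L := C)).
by move/eqP; rewrite pexprn_eq1 ?nrm_ge0 // gtn_eqF ?pred_card_gt0 // => /eqP.
Qed.

Lemma nrm_const_le1 c : nrm (k c) <= 1.
Proof.
by have [->|/nrm_const->//] := eqVneq c 0; rewrite !rmorph0 nrm0 ler01.
Qed.

Lemma nrm_iota (f : {poly F}) : f != 0 -> nrm (iota f) = q ^+ (size f).-1.
Proof.
elim/poly_ind: f => [|f c IHf]; first by rewrite eqxx.
have [->|f0] := eqVneq f 0.
  rewrite mul0r add0r polyC_eq0 => c0.
  by rewrite nrm_const // size_polyC c0 expr0.
move=> _; have sf : size (f * 'X + c%:P) = (size f).+1.
  by rewrite size_MXaddC (negbTE f0).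
have fX : nrm (iota (f * 'X)) = q ^+ size f.
  by rewrite rmorphM nrmM IHf // normT -exprSr prednK // size_poly_gt0.
rewrite sf -fX; apply: nrm_dominant.
rewrite rmorphD addrAC subrr add0r fX (le_lt_trans (nrm_const_le1 _)) //.
by rewrite exprn_egt1 ?card_gt1 // size_poly_eq0.
Qed.

Lemma nrm_iota_lt (f : {poly F}) n : nrm (iota f) < q ^+ n -> (size f <= n)%N.
Proof.
have [->|f0] := eqVneq f 0; first by rewrite size_poly0.
by rewrite nrm_iota // ltr_eXn2l ?card_gt1 //; move: f0; rewrite -size_poly_gt0; lia.
Qed.

Lemma nrm_iota_ge1 (f : {poly F}) : f != 0 -> 1 <= nrm (iota f).
Proof. by move=> f0; rewrite nrm_iota // exprn_ege1 // ltW // card_gt1. Qed.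

Lemma iota_eq0 (f : {poly F}) : (iota f == 0) = (f == 0).
Proof.
have [->|f0] := eqVneq f 0; first by rewrite rmorph0 eqxx.
by apply/negbTE; rewrite -nrm_gt0; apply: lt_le_trans ltr01 (nrm_iota_ge1 f0).
Qed.

Lemma T_neq0 : T != 0. Proof. by rewrite iota_eq0 polyX_eq0. Qed.

Lemma card_expn_unbounded (B : R) : exists n, forall m, (n <= m)%N -> B < q ^+ m.
Proof.
have [n nB] : exists n : nat, B < n%:R.
  by exists (Num.truncn B).+1; apply: truncnS_gt.
exists n => m nm; apply: lt_le_trans nB _.
apply: le_trans (_ : m%:R <= _); first by rewrite ler_nat.
by rewrite -natrX ler_nat ltnW // ltn_expl // finNzRing_gt1.
Qed.

(* If [T ^ m z] lies at distance less than 1 from the polynomial [f m], then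
   [f m.+1 - 'X * f m] is a constant, the next digit of [z]. *)
Lemma approx_Finfty (z : C) :
  (forall m, exists f : {poly F}, nrm (T ^+ m * z - iota f) < 1) -> Finfty iota z.
Proof.
move=> /choice[f fP].
have T0 := T_neq0.
have digit m : f m.+1 = 'X * f m + ((f m.+1 - 'X * f m)`_0)%:P.
  rewrite -size1_polyC ?subrKC //; apply: nrm_iota_lt.
  have -> : iota (f m.+1 - 'X * f m) =
      T * (T ^+ m * z - iota (f m)) - (T ^+ m.+1 * z - iota (f m.+1)).
    by rewrite rmorphB rmorphM exprS /=; ring.
  rewrite expr1; apply: nrmD_lt; last by rewrite nrmN (lt_trans (fP _)) ?card_gt1.
  by rewrite nrmM normT -[ltRHS]mulr1 ltr_pM2l ?card_gt0.
(* The digits of the integer part [f 0] come first. [N] is its size, not its degree, so [c 0 = 0]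
   and the case [f 0 = 0] is covered. *)
pose N := size (f 0%N).
pose c i := if (i <= N)%N then (f 0%N)`_(N - i)%N
            else (f (i - N)%N - 'X * f (i - N).-1%N)`_0.
exists N, c.
have partial m : series (fun i => k (c i) * T ^+ N / T ^+ i) (N + m).+1 =
    iota (f m) / T ^+ m.
  elim: m => [|m IHm].
    rewrite addn0 /series /= big_mkord expr0 divr1.
    rewrite (reindex_inj rev_ord_inj) /=.
    rewrite -[in RHS](coefK (f 0%N)) poly_def rmorph_sum /= big_ord_recr /=.
    rewrite [X in _ + X](_ : _ = 0) ?addr0; last first.
      by rewrite /c subSS subnn leq0n subn0 nth_default // rmorph0 !mul0r.
    apply: eq_bigr => i _; rewrite -/N /c subSS leq_subr subKn; last exact: ltnW.
    rewrite -mul_polyC rmorphM rmorphXn -mulrA; congr (_ * _) => /=.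
    by rewrite -{1}(subnKC (ltnW (ltn_ord i))) exprD mulfK ?expf_neq0.
  rewrite addnS /series /= big_nat_recr //= -/(series _ _).
  rewrite -[\sum_(0 <= _ < _) _]/(series _ (N + m).+1) IHm.
  rewrite /c leqNgt ltnS leq_addr /= subSn ?leq_addr // addKn /= {2}digit.
  rewrite rmorphD rmorphM /= mulrDl -addnS exprD invfM mulrA.
  congr (_ + _); first by rewrite exprS; field; rewrite expf_neq0 ?T0.
  by rewrite mulfK ?expf_neq0.
apply/(@cvg_ballP R C) => eps eps0.
have [n0 H] := card_expn_unbounded eps^-1.
exists (N + n0).+1 => // n /= Nn.
have [m -> nm] : exists2 m, n = (N + m).+1 & (n0 <= m)%N.
  by exists (n - N.+1)%N; lia.
rewrite partial ballEmdist /= /mdist /= /abs_dist -/(nrm _).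
have -> : z - iota (f m) / T ^+ m = (T ^+ m * z - iota (f m)) / T ^+ m.
  by field; rewrite expf_neq0.
rewrite nrmM nrmV nrmX normT ltr_pdivrMr ?exprn_gt0 ?card_gt0 //.
apply: lt_trans (fP m) _; rewrite mulrC -ltr_pdivrMr // mul1r.
exact: H.
Qed.

Lemma Omega_dist (z : C) : Omega iota z ->
  exists m, forall f : {poly F}, 1 <= nrm (T ^+ m * z - iota f).
Proof.
move=> zO; apply: contrapT => H; apply: zO; apply: approx_Finfty => m.
apply: contrapT => H'; apply: H; exists m => f.
by rewrite leNgt; apply/negP => fm; apply: H'; exists f.
Qed.

(** If T^m (a z + b) were smaller than [a], dividing T^m b by [a] with remainder would place a
    polynomial, minus the quotient, at distance less than 1 from T^m z, against [Omega_dist]. The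
    bound for [b] follows from b = (a z + b) - a z. *)
Lemma Omega_bound (z : C) : Omega iota z -> exists2 K : R, 1 <= K &
  forall a b : {poly F}, nrm (iota a) <= K * nrm (iota a * z + iota b) /\
                         nrm (iota b) <= K * nrm (iota a * z + iota b).
Proof.
move=> /Omega_dist[m Hm].
have q1 : 1 <= q ^+ m by rewrite exprn_ege1 // ltW ?card_gt1.
exists (q ^+ m * Num.max 1 (nrm z)) => [|a b].
  by rewrite (le_trans q1) // ler_peMr ?le_max ?lexx // (le_trans ler01).
have Ha : nrm (iota a) <= q ^+ m * nrm (iota a * z + iota b).
  have [->|a0] := eqVneq a 0.
    by rewrite rmorph0 nrm0 mulr_ge0 ?nrm_ge0 // (le_trans ler01).
  rewrite leNgt; apply/negP => lt_a.
  have na0 : 0 < nrm (iota a) by rewrite nrm_gt0 iota_eq0.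
  suff : nrm (iota a) * nrm (T ^+ m * z - iota (- ('X^m * b %/ a))) < nrm (iota a).
    by rewrite ltNge ler_peMr ?nrm_ge0.
  rewrite -nrmM; have -> : iota a * (T ^+ m * z - iota (- ('X^m * b %/ a))) =
      T ^+ m * (iota a * z + iota b) - iota (('X^m * b) %% a).
    have := congr1 iota (divp_eq ('X^m * b) a); rewrite rmorphD !rmorphM rmorphXn /=.
    by move=> E; rewrite rmorphN [T ^+ m * (_ + _)]mulrDr E; ring.
  apply: nrmD_lt; first by rewrite nrmM nrmX normT.
  rewrite nrmN [X in _ < X]nrm_iota //.
  have [->|r0] := eqVneq ('X^m * b %% a) 0.
    by rewrite rmorph0 nrm0 exprn_gt0 ?card_gt0.
  rewrite nrm_iota // ltr_eXn2l ?card_gt1 //.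
  have ra : (size (('X^m * b) %% a)%R < size a)%N by rewrite ltn_modp.
  move: r0; rewrite -size_poly_gt0; move: ra.
  by case: (size (_ %% _)) => // s; case: (size a).
have le1 : nrm (iota a * z + iota b) <= q ^+ m * nrm (iota a * z + iota b).
  by rewrite ler_peMl ?nrm_ge0.
have n0 := nrm_ge0 (iota a * z + iota b).
have bE : iota b = (iota a * z + iota b) - iota a * z by rewrite addrC addKr.
move: bE Ha le1 n0; set v := iota a * z + iota b => bE Ha le1 n0.
split.
  apply: le_trans Ha _; rewrite -mulrA ler_pM2l ?exprn_gt0 ?card_gt0 //.
  by rewrite ler_peMl // le_max lexx.
rewrite bE; apply: nrmB_le.
  apply: le_trans le1 _; rewrite -mulrA ler_pM2l ?exprn_gt0 ?card_gt0 //.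
  by rewrite ler_peMl // le_max lexx.
rewrite nrmM mulrAC; apply: ler_pM => //; rewrite ?nrm_ge0 //.
by rewrite le_max lexx orbT.
Qed.
End CinftyNorm.

(** * The reciprocal of the exponential of A *)

Section Enumeration.
Variable F : finFieldType.

Definition polys n : {fset {poly F}} :=
  [fset f in [seq polyn f | f <- enum {poly_n F}]]%fset.

Lemma in_polys n (f : {poly F}) : (f \in polys n) = (size f <= n)%N.
Proof.
rewrite !inE; apply/mapP/idP => [[g _ ->]|fn]; first exact: size_npoly.
by exists (NPoly (fn : f \is a poly_of_size n)); rewrite ?mem_enum.
Qed.

Definition matrices n : seq 'M[{poly F}]_2 :=
  [seq map_mx (@polyn F n) M | M <- enum 'M[{poly_n F}]_2].

Lemma in_matrices n (M : 'M[{poly F}]_2) :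
  (forall a b, size (M a b) <= n)%N -> M \in matrices n.
Proof.
move=> Mn; apply/mapP.
exists (\matrix_(a, b) NPoly (Mn a b : M a b \is a poly_of_size n)).
  by rewrite mem_enum.
by apply/matrixP => a b; rewrite !mxE.
Qed.

Definition sub_matrices (P : pred 'M[{poly F}]_2) n : {fset {g | P g}} :=
  [fset g in pmap insub (matrices n)]%fset.

Lemma in_sub_matrices (P : pred 'M[{poly F}]_2) n (g : {g | P g}) :
  (forall a b, size (val g a b) <= n)%N -> g \in sub_matrices P n.
Proof. by move=> gn; rewrite !inE mem_pmap_sub in_matrices. Qed.

Lemma sub_matrices_size (P : pred 'M[{poly F}]_2) n (g : {g | P g}) :
  g \in sub_matrices P n -> forall a b, (size (val g a b) <= n)%N.
Proof.
rewrite !inE mem_pmap_sub => /mapP[M _ ->] a b.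
by rewrite mxE size_npoly.
Qed.

(* Every polynomial of size at most [n.+1] is uniquely [a - c X^n]. *)
Lemma big_polysS (T : Type) (idx : T) (op : Monoid.com_law idx) n (x : {poly F} -> T) :
  \big[op/idx]_(a <- polys n.+1) x a =
  \big[op/idx]_c \big[op/idx]_(a <- polys n) x (a - c%:P * 'X^n).
Proof.
transitivity (\big[op/idx]_(a <- [seq a - c%:P * 'X^n | c <- index_enum F, a <- polys n]) x a);
  last by rewrite big_allpairs_dep.
apply: perm_big; apply: uniq_perm => //.
  apply: allpairs_uniq; rewrite ?index_enum_uniq ?fset_uniq //.
  move=> u v /allpairsP[[c a] /= [_ sa ->]] /allpairsP[[c' a'] /= [_ sa' ->]] /= E.
  rewrite !in_polys in sa sa'; move/leq_sizeP: sa => sa; move/leq_sizeP: sa' => sa'.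
  have cE : c = c'.
    move/(congr1 (fun f : {poly F} => f`_n)): E.
    rewrite !coefB !coefCM coefXn eqxx !mulr1 sa // sa' // !sub0r.
    by move/oppr_inj.
  by move: E; rewrite cE => /addIr ->.
move=> f; apply/idP/allpairsP => [|[[c a] [_ + ->]]]; rewrite !in_polys /= => sf.
  exists (- f`_n, f - (f`_n)%:P * 'X^n); split; rewrite ?mem_index_enum //=.
    rewrite in_polys size_leS_coef ?coefB ?coefCM ?coefXn ?eqxx ?mulr1 ?subrr //.
    rewrite (leq_trans (size_polyD _ _)) // geq_max sf size_polyN mul_polyC.
    by rewrite (leq_trans (size_scale_leq _ _)) ?size_polyXn.
  by rewrite polyCN mulNr opprK subrK.
rewrite (leq_trans (size_polyD _ _)) // geq_max (leqW sf) size_polyN mul_polyC.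
by rewrite (leq_trans (size_scale_leq _ _)) ?size_polyXn.
Qed.

Lemma polys0 : polys 0 = [fset 0]%fset.
Proof. by apply/fsetP => f; rewrite in_polys size_poly_leq0 inE. Qed.
End Enumeration.

Section TA.
Variables (R : realType) (F : finFieldType) (C : valuedField R).
Variable iota : {rmorphism {poly F} -> C}.
Variables (p e : nat).
Hypotheses (p_pr : prime p) (card_F : #|F| = (p ^ e)%N).
Hypothesis normT : nrm (iota 'X) = #|F|%:R :> R.
Hypothesis Ccomp :
  (forall G : set_system C, ProperFilter G -> cauchy G -> cvg G)%classic.
Local Notation q := (#|F|%:R : R).
Local Notation k c := (iota c%:P).
Local Notation T := (iota 'X).

(** Only finitely many matrices have all entries of bounded degree; outside them some entry is large
    and forces [x g] to be small. *)
Lemma null_matrices (P : pred 'M[{poly F}]_2) (x : {g | P g} -> C) (B : R) :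
    (forall g a b, nrm (x g) * nrm (iota (val g a b)) <= B) -> null_family x.
Proof.
move=> xB eps eps0; have [n Hn] := card_expn_unbounded F (B / eps).
exists (sub_matrices P n.+1) => g gn.
have [[a b] ab] : exists ab : 'I_2 * 'I_2, (n.+1 < size (val g ab.1 ab.2))%N.
  apply/existsP; apply: contraR gn => /existsPn H; apply: in_sub_matrices => a b.
  by rewrite leqNgt (H (a, b)).
have f0 : val g a b != 0 by rewrite -size_poly_gt0; apply: leq_trans ab.
have := xB g a b; rewrite nrm_iota //.
have qn0 : 0 < q ^+ (size (val g a b)).-1 by rewrite exprn_gt0 // card_gt0.
rewrite -ler_pdivlMr // => /le_trans; apply; rewrite ler_pdivrMr // mulrC.
rewrite -ler_pdivrMr // ltW // Hn //.
by move: ab => /=; case: (size _) => // s ns; exact: ltnW.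
Qed.

Lemma null_inv_sub (w : C) : null_family (fun a : {poly F} => (w - iota a)^-1).
Proof.
move=> eps eps0.
have [n Hn] := card_expn_unbounded F (nrm w); have [m Hm] := card_expn_unbounded F eps^-1.
exists (polys F (maxn n m).+1) => a; rewrite in_polys -ltnNge => sa.
have a0 : a != 0 by rewrite -size_poly_gt0; apply: leq_trans sa.
have wa : nrm w < nrm (iota a) by rewrite nrm_iota // Hn //; lia.
have -> : (w - iota a)^-1 = - (iota a - w)^-1 by rewrite -invrN opprB.
rewrite nrmN nrmV (@nrm_dominant _ _ _ (iota a)); last first.
  by rewrite addrAC subrr add0r nrmN.
rewrite nrm_iota // -[eps]invrK lef_pV2 ?posrE ?invr_gt0 ?exprn_gt0 ?card_gt0 //.
by rewrite ltW // Hm //; lia.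
Qed.

Local Notation E n := (espan1 iota 1 n).
Local Notation D n := (dspan1 iota 1 n).

Lemma E_line n c w : E n (w + iota (c%:P * 'X^n)) = E n w + k c * E n (T ^+ n * 1).
Proof.
have := espan_Flinear iota p_pr card_F 1 0 n 0 c w (T ^+ n * 1).
by rewrite rmorphM rmorphXn /= mulr1.
Qed.

Lemma E_polys n w : \prod_(a <- polys F n) (w - iota a) = E n w.
Proof.
elim: n w => [|n IHn] w; first by rewrite polys0 big_seq_fset1 rmorph0 subr0.
rewrite big_polysS /=.
transitivity (\prod_c (E n w + k c * E n (T ^+ n * 1))).
  apply: eq_bigr => c _; rewrite -E_line -IHn.
  by apply: eq_bigr => a _; rewrite rmorphB opprB addrA.
by rewrite prod_line.
Qed.

Lemma E_neq0 n w : (forall a, w != iota a) -> E n w != 0.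
Proof.
move=> wA; apply/eqP => /(@espan_eq0 _ _ _ _ _ p_pr card_F 1 0 n 0)[a [b [_ _ wE]]].
by have := wA a; rewrite wE mulr0 addr0 mulr1 eqxx.
Qed.

Lemma ET_neq0 n : E n (T ^+ n * 1) != 0.
Proof.
apply/eqP => /(@espan_eq0 _ _ _ _ _ p_pr card_F 1 0 n 0)[a [b [sa _ wE]]].
move: wE; rewrite mulr0 addr0 !mulr1 -rmorphXn => /eqP.
rewrite -subr_eq0 -rmorphB iota_eq0 // subr_eq0 => /eqP aE.
by rewrite -aE size_polyXn ltnn in sa.
Qed.

(** The logarithmic derivative of [E n], an F-linear polynomial, whose derivative is thus the
    constant [D n]. *)
Lemma sum_polys_inv n w : (forall a, w != iota a) ->
  \sum_(a <- polys F n) (w - iota a)^-1 = D n / E n w.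
Proof.
elim: n w => [|n IHn] w wA; first by rewrite polys0 big_seq_fset1 rmorph0 subr0 mul1r.
have wA' c a : w + iota (c%:P * 'X^n) != iota a.
  apply: contraNneq (wA (a - c%:P * 'X^n)) => wE.
  by rewrite rmorphB -wE addrK.
rewrite big_polysS /=.
transitivity (\sum_c D n * (E n w + k c * E n (T ^+ n * 1))^-1).
  apply: eq_bigr => c _; rewrite -E_line -IHn //.
  by apply: eq_bigr => a _; rewrite rmorphB opprB addrA.
rewrite -mulr_sumr (sum_line_inv p_pr card_F) ?ET_neq0 // => [|c].
  by rewrite /step mulrA [D n * _]mulrC.
by rewrite -E_line; apply: E_neq0.
Qed.

(** Wilson's theorem, from X^(q-1) - 1 at 0; the substitution of -c for c absorbs the signs. *)
Lemma prod_const : \prod_(c : F | c != 0) c = -1.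
Proof.
have : 'X * \prod_(c : F | c != 0) ('X - c%:P) = 'X * ('X^(#|F|.-1) - 1) :> {poly F}.
  rewrite mulrBr mulr1 -exprS card_predK finField_genPoly [RHS](bigD1 0) //=.
  by rewrite polyC0 subr0.
move/(mulfI (negbT (polyX_eq0 _)))/(congr1 (fun f : {poly F} => f.[0])).
rewrite horner_prod !hornerE expr0n gtn_eqF ?pred_card_gt0 // sub0r => <-.
rewrite [RHS](reindex_inj oppr_inj); apply: eq_big => c; rewrite ?oppr_eq0 //.
by rewrite !hornerE opprK.
Qed.

Lemma D_polys n : \prod_(b <- polys F n | b != 0) - iota b = D n.
Proof.
elim: n => [|n IHn]; rewrite big_mkcond; first by rewrite polys0 big_seq_fset1 eqxx.
rewrite big_polysS (bigD1 0) //= polyC0.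
under eq_bigr do rewrite mul0r subr0.
rewrite -big_mkcond IHn mulrC; congr (_ * _).
transitivity (\prod_(c : F | c != 0) (k c * E n (T ^+ n * 1))).
  apply: eq_bigr => c c0; have <- := FlinearZ c (T ^+ n * 1) (@espan_Flinear _ _ iota _ _ p_pr card_F 1 0 n 0).
  rewrite -[espan _ _ _ _ _]/(E n) -E_polys big_seq [RHS]big_seq.
  apply: eq_bigr => a; rewrite in_polys => sa.
  have -> /= : a - c%:P * 'X^n != 0.
    apply: contraTneq sa => /eqP; rewrite subr_eq0 => /eqP ->.
    by rewrite -ltnNge mul_polyC size_scale // size_polyXn.
  by rewrite rmorphB opprB rmorphM rmorphXn mulr1.
rewrite big_split /= -(rmorph_prod (iota \o polyC)) prod_const /= polyCN rmorphN1.
rewrite mulN1r; congr (- _); rewrite prodr_const; congr (_ ^+ _).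
by rewrite cardC1.
Qed.

Lemma nrm_prod_small (I : choiceType) (y : I -> C) (S : seq I) (eps : R) :
    0 <= eps <= 1 -> (forall i, i \in S -> nrm (y i) <= eps) ->
  nrm (\prod_(i <- S) (1 - y i) - 1) <= eps.
Proof.
move=> /andP[eps0 eps1]; elim: S => [|i S IHS] yS.
  by rewrite big_nil subrr nrm0.
rewrite big_cons.
have {}IHS : nrm (\prod_(i <- S) (1 - y i) - 1) <= eps.
  by apply: IHS => j jS; apply: yS; rewrite inE jS orbT.
have yi := yS i (mem_head _ _).
set P := \prod_(_ <- _) _ in IHS *.
have -> : (1 - y i) * P - 1 = (P - 1) - y i * ((P - 1) + 1) by ring.
apply: nrmB_le => //; rewrite nrmM -[eps]mulr1; apply: ler_pM => //; rewrite ?nrm_ge0 //.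
by apply: nrmD_le; rewrite ?nrm1 // (le_trans IHS).
Qed.

Lemma null_prod (I : choiceType) (y : I -> C) : null_family y ->
  exists u, netlim (fun S : {fset I} => \prod_(i <- S) (1 - y i)) u.
Proof.
move=> y0; apply: net_cauchy => // eps eps0.
have [S1 H1] := y0 1 ltr01.
(* Factors outside [S1] have norm at most 1, so [K] bounds all partial products containing [S1];
   adding 1 makes it positive. *)
pose K := nrm (\prod_(i <- S1) (1 - y i)) + 1.
have K0 : 0 < K by rewrite ltr_wpDl ?nrm_ge0.
have d0 : 0 < Num.min 1 (eps / K) by rewrite lt_min ltr01 divr_gt0.
have half : 0 <= (1 : R) <= 1 by rewrite lexx andbT ler01.
have [S2 H2] := y0 _ d0; exists (S1 `|` S2)%fset => S SS.
rewrite (big_fsetD _ _ SS) /= -[X in _ - X]mulr1 -mulrBr nrmM.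
have -> : eps = K * (eps / K) by rewrite mulrC divfK ?gt_eqF.
apply: ler_pM; rewrite ?nrm_ge0 //.
  rewrite (big_fsetD _ _ (fsubsetUl S1 S2)) /= nrmM -[K]mulr1.
  apply: ler_pM; rewrite ?nrm_ge0 ?lerDl ?ler01 //.
  rewrite -[\prod_(_ <- _) _](subrK 1) nrmD_le ?nrm1 //.
  apply: nrm_prod_small => // i; rewrite in_fsetD => /andP[+ _].
  exact: H1.
have d1 : 0 <= Num.min 1 (eps / K) <= 1 by rewrite ltW // ge_min lexx.
apply: le_trans (nrm_prod_small d1 _) _; last by rewrite ge_min lexx orbT.
by move=> i; rewrite in_fsetD in_fsetU negb_or => /andP[/andP[_ /H2]].
Qed.

(** At level n the sum is [D n / E n w] and w times the product is [E n w / D n]. In the limit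
    [l * u = w^-1], which also shows that the product [u] is nonzero. *)
Lemma t_A_sum w : (forall a, w != iota a) ->
  sums_to (fun a : {poly F} => (w - iota a)^-1) (t_A iota w).
Proof.
move=> wA.
have [l Hl] := null_sums_to Ccomp (null_inv_sub w).
suff -> : t_A iota w = l by [].
pose nz := {b : {poly F} | b != 0}.
have y0 : null_family (fun b : nz => w / iota (val b)).
  apply: null_familyZ => eps eps0.
  have [n Hn] := card_expn_unbounded F eps^-1.
  exists [fset b in pmap insub (polys F n.+1)]%fset => b.
  rewrite !inE mem_pmap_sub in_polys -ltnNge => sb.
  rewrite nrmV nrm_iota ?(valP b) // -[eps]invrK lef_pV2 ?posrE ?invr_gt0 ?exprn_gt0 ?card_gt0 //.
  by rewrite ltW // Hn //; case: (size _) sb => // s ns; exact: ltnW.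
have [u Hu] := null_prod y0.
have eE : e_A iota w = w * u by rewrite /e_A /uprod (netlim_lim Hu).
pose S n : {fset nz} := [fset b in pmap insub (polys F n)]%fset.
have Sn n : w * \prod_(b <- S n) (1 - w / iota (val b)) = E n w / D n.
  rewrite -E_polys -D_polys (bigD1_seq 0) ?in_polys ?size_poly0 ?fset_uniq //=.
  rewrite rmorph0 subr0 -mulrA -prodf_div; congr (_ * _).
  transitivity (\prod_(b <- pmap insub (polys F n) : seq nz) (1 - w / iota (val b))).
    apply: perm_big; apply: uniq_perm; rewrite ?pmap_sub_uniq ?fset_uniq //.
    by move=> b; rewrite !inE.
  rewrite -(big_map val xpredT (fun b => 1 - w / iota b)).
  rewrite (pmap_filter (insubK nz)) big_filter.
  apply: eq_big => b; first by rewrite isSome_insub.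
  rewrite isSome_insub => b0; have : iota b != 0 by rewrite iota_eq0.
  by move=> ib; field; rewrite oppr_eq0 ib.
have Slim : seqlim (fun n => \prod_(b <- S n) (1 - w / iota (val b))) u.
  apply: netlim_seq Hu => b; exists (size (val b)) => m bm.
  by rewrite !inE mem_pmap_sub in_polys.
have D0 n : D n != 0.
  by elim: n => [|n IHn] /=; rewrite ?oner_neq0 // mulf_neq0 // oppr_eq0 expf_neq0 ?ET_neq0.
have lim1 : seqlim (fun n => (\sum_(a <- polys F n) (w - iota a)^-1) *
   \prod_(b <- S n) (1 - w / iota (val b))) (l * u).
  apply: seqlimM Slim; apply: (@netlim_seq _ _ _ _ l (polys F)) Hl => a.
  by exists (size a) => m; rewrite in_polys.
have w0 : w != 0 by have := wA 0; rewrite rmorph0.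
have lu : l * u = w^-1.
  apply: seqlim_uniq lim1 _ => eps eps0; exists 0%N => n _.
  rewrite sum_polys_inv // -[X in _ * X](mulKf w0) Sn.
  have := E_neq0 n wA => E0.
  rewrite (_ : _ - _ = 0) ?nrm0 ?ltW //; apply/eqP; rewrite subr_eq0; apply/eqP.
  by field; rewrite w0 D0 E0.
have u0 : u != 0.
  by apply: contraNneq (w0) => u0; rewrite -invr_eq0 -lu u0 mulr0.
by rewrite /t_A eE invfM -lu mulfK.
Qed.
End TA.

(** * The Poincare series h *)

Lemma inj_surj_bijective (A B : Type) (f : A -> B) :
  injective f -> (forall y, exists x, f x = y) -> bijective f.
Proof.
move=> fI /choice[g gK]; exists g => // x.
by apply: fI; rewrite gK.
Qed.

(** * The sum over SL_2(F) *)

Section SL2Sum.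
Variables (F : finFieldType) (L : fieldType) (iota : {rmorphism {poly F} -> L}).
Variables (p e : nat).
Hypotheses (p_pr : prime p) (card_F : #|F| = (p ^ e)%N) (q_odd : odd #|F|).
Local Notation r := #|F|.-1.
Local Notation k c := (iota c%:P).

Definition mx22 (R : Type) (a b c d : R) : 'M[R]_2 :=
  \matrix_(i, j) if i == 0 then (if j == 0 then a else b)
                 else (if j == 0 then c else d).

(* For [(c, d) != (0, 0)] these are, as [t] varies, the matrices of determinant 1
   with second row [(c, d)]. *)
Definition SL2_mx (x : (F * F) * F) : 'M[F]_2 :=
  let: ((c, d), t) := x in
  if c != 0 then mx22 (t * c) (t * d - c^-1) c d
  else mx22 (d^-1) (t * d) c d.

Lemma SL2_mx_det (x : (F * F) * F) : (\det (SL2_mx x) == 1) = (x.1 != (0, 0)).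
Proof.
case: x => [[c d] t]; rewrite det2 /SL2_mx xpair_eqE /=.
have [->|c0] := eqVneq c 0; rewrite !mxE /=.
  rewrite mulr0 subr0; have [->|d0] := eqVneq d 0; first by rewrite invr0 mul0r eq_sym oner_eq0.
  by rewrite mulVf ?eqxx.
by apply/eqP; field.
Qed.

Lemma SL2_mx_bij : {on [pred s | \det s == 1], bijective SL2_mx}.
Proof.
pose t (s : 'M[F]_2) := if s 1 0 != 0 then s 0 0 / s 1 0 else s 0 1 / s 1 1.
exists (fun s : 'M[F]_2 => ((s 1 0, s 1 1), t s)) => [[[c d] u]|s].
  rewrite inE SL2_mx_det /= xpair_eqE /SL2_mx /t.
  have [->|c0] := eqVneq c 0; rewrite /= !mxE /=; last by rewrite c0 mulfK.
  by rewrite eqxx /= => d0; rewrite mulfK.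
rewrite inE det2 => /eqP s1; rewrite /SL2_mx /t.
have [c0|c0] := eqVneq (s 1 0) 0; rewrite /=.
  move: s1; rewrite c0 mulr0 subr0 => s1.
  have d0 : s 1 1 != 0 by apply: contra_eq_neq s1 => ->; rewrite mulr0 eq_sym oner_neq0.
  apply/matrixP; apply: I2P; apply: I2P; rewrite !mxE ?c0 ?divfK //=.
  by apply: (mulIf d0); rewrite s1 mulVf.
apply/matrixP; apply: I2P; apply: I2P; rewrite !mxE ?divfK //=.
apply: (mulIf c0); rewrite mulrBl mulVf // -s1.
by field.
Qed.

(** For a fixed second row the first row runs through a line y + t x, and the sum over [t] is 1/M(u,
    v) whatever the row. There are q^2 - 1 nonzero rows, and q = 0 in [L]. *)
Lemma sum_SL2 (u v : L) : (forall c d : F, (c, d) != (0, 0) -> k c * u + k d * v != 0) ->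
  \sum_(s : 'M[F]_2 | \det s == 1)
     ((k (s 1 0) * u + k (s 1 1) * v) ^+ r.+1 * (k (s 0 0) * u + k (s 0 1) * v))^-1
  = - (moore2 F u v)^-1.
Proof.
move=> uv0.
rewrite (reindex _ SL2_mx_bij) (eq_bigl _ _ SL2_mx_det).
pose x (cd : F * F) := k cd.1 * u + k cd.2 * v.
pose y cd := k (SL2_mx (cd, 0) 0 0) * u + k (SL2_mx (cd, 0) 0 1) * v.
have row1 cd t : (SL2_mx (cd, t) 1 0 = cd.1) * (SL2_mx (cd, t) 1 1 = cd.2).
  by case: cd => c d; rewrite /SL2_mx; case: (c != 0); rewrite !mxE.
have row0 cd t : k (SL2_mx (cd, t) 0 0) * u + k (SL2_mx (cd, t) 0 1) * v = y cd + k t * x cd.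
  case: cd => c d; rewrite /x /y /SL2_mx.
  have [c0|c0] := eqVneq c 0; rewrite /= !mxE /= ?(mul0r, add0r, c0) ?mulr0 ?rmorph0 ?mul0r ?add0r.
    by rewrite polyCM rmorphM; ring.
  by rewrite !(polyCB, polyCN, polyCM) !(rmorphB, rmorphN, rmorphM) /=; ring.
transitivity (\sum_(cd | cd != (0, 0)) \sum_(t : F) (x cd ^+ r.+1)^-1 * (y cd + k t * x cd)^-1).
  rewrite pair_big /=; apply: eq_big => [[cd t]|[cd t] cd0]; first by rewrite /= andbT.
  by rewrite !row1 row0 invfM.
have M0 : moore2 F u v != 0.
  have u0 : u != 0 by have := uv0 1 0; rewrite !rmorph0 !rmorph1 mul0r addr0 mul1r; apply; rewrite xpair_eqE oner_eq0.
  rewrite (moore2_prod iota) mulf_neq0 //; apply/prodf_neq0 => c _.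
  have := uv0 c 1; rewrite !rmorph1 mul1r addrC; apply.
  by rewrite xpair_eqE oner_eq0 andbF.
transitivity (\sum_(cd : F * F | cd != (0, 0)) (moore2 F u v)^-1).
  apply: eq_bigr => cd cd0.
  have x0 : x cd != 0 by apply: uv0; case: cd cd0.
  have yline t : y cd + k t * x cd != 0.
    have := SL2_mx_det (cd, t); rewrite cd0 -row0 => /eqP dS; apply: uv0.
    apply: contra_eq_neq dS => -[s0 s1].
    by rewrite det2 s0 s1 !mul0r subrr eq_sym oner_neq0.
  (* The pair x, y arises from u, v by a matrix of determinant 1 with its rows exchanged, hence the
     sign. *)
  have Mxy : x cd * (y cd ^+ r.+1 - x cd ^+ r * y cd) = - moore2 F u v.
    rewrite -moore2E; set s := SL2_mx (cd, 0).
    have := moore2_lin iota p_pr card_F (mx22 (s 1 0) (s 0 0) (s 1 1) (s 0 1)) u v.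
    have := SL2_mx_det (cd, 0); rewrite cd0 => /eqP; rewrite det2 -/s => dS.
    have -> : \det (mx22 (s 1 0) (s 0 0) (s 1 1) (s 0 1)) = -1.
      by rewrite det2 !mxE /= -dS; ring.
    by rewrite !mxE /= !row1 polyCN !rmorphN1 mulN1r.
  rewrite -mulr_sumr (sum_line_inv p_pr card_F) // exprSr -[moore2 F u v]opprK -Mxy.
  have D0 : y cd ^+ r.+1 - x cd ^+ r * y cd != 0.
    by rewrite -(prod_line iota); apply/prodf_neq0.
  have xr0 : x cd ^+ r != 0 by rewrite expf_neq0.
  move: (y cd ^+ r.+1 - _) D0 => D D0; move: (x cd ^+ r) xr0 => a a0.
  by field; rewrite D0 x0 a0 oppr_eq0 mulf_neq0.
have card_nz : #|[pred cd : F * F | cd != (0, 0)]| = (#|F| * #|F|).-1.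
  by rewrite cardC1 card_prod.
rewrite sumr_const card_nz; apply/eqP; rewrite -subr_eq0 opprK -mulrSr.
rewrite prednK; last by rewrite muln_gt0 (cardD1 0).
by rewrite mulrnA -mulr_natr (card_natr0 iota p_pr card_F) mulr0.
Qed.
End SL2Sum.

(** * The sum over SL_2(A), regrouped by SL_2(F) and by K *)

Section HSum.
Variables (R : realType) (F : finFieldType) (C : valuedField R).
Variable iota : {rmorphism {poly F} -> C}.
Variables (p e : nat).
Hypotheses (p_pr : prime p) (card_F : #|F| = (p ^ e)%N) (q_odd : odd #|F|).
Hypothesis normT : nrm (iota 'X) = #|F|%:R :> R.
Hypothesis Ccomp :
  (forall G : set_system C, ProperFilter G -> cauchy G -> cvg G)%classic.
Variables (z : C) (K : R).
Hypothesis K1 : 1 <= K.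
Hypothesis zK : forall a b : {poly F},
  nrm (iota a) <= K * nrm (iota a * z + iota b) /\
  nrm (iota b) <= K * nrm (iota a * z + iota b).
Local Notation q := (#|F|%:R : R).
Local Notation r := #|F|.-1.
Local Notation k c := (iota c%:P).
Local Notation T := (iota 'X).
Local Notation A := {poly F}.

Definition lat (a b : A) : C := iota a * z + iota b.

Let K0 : 0 < K. Proof. exact: lt_le_trans ltr01 K1. Qed.

Lemma lat_ge (a b : A) : (a != 0) || (b != 0) -> K^-1 <= nrm (lat a b).
Proof.
move=> ab; rewrite -[K^-1]mulr1 ler_pdivrMl //; have [Ha Hb] := zK a b.
by case/orP: ab => /(nrm_iota_ge1 normT)/le_trans; apply.
Qed.

Lemma lat_neq0 (a b : A) : (a != 0) || (b != 0) -> lat a b != 0.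
Proof.
move=> ab; rewrite -nrm_gt0; apply: lt_le_trans (lat_ge ab).
by rewrite invr_gt0.
Qed.

Lemma lat_inv_le (a b : A) : (a != 0) || (b != 0) -> nrm (lat a b)^-1 <= K.
Proof.
move=> ab; rewrite nrmV -[K]invrK lef_pV2 ?lat_ge // posrE ?invr_gt0 //.
by rewrite nrm_gt0 lat_neq0.
Qed.

Definition SL2 := {s : 'M[A]_2 | \det s == 1}.

Lemma det1_row0 (s : 'M[A]_2) : \det s = 1 -> (s 0 0 != 0) || (s 0 1 != 0).
Proof.
move=> s1; rewrite -negb_and; apply: contra_eqN s1 => /andP[/eqP a0 /eqP b0].
by rewrite det2 a0 b0 !mul0r subrr eq_sym oner_neq0.
Qed.

Lemma det1_row1 (s : 'M[A]_2) : \det s = 1 -> (s 1 0 != 0) || (s 1 1 != 0).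
Proof.
move=> s1; rewrite -negb_and; apply: contra_eqN s1 => /andP[/eqP a0 /eqP b0].
by rewrite det2 a0 b0 !mulr0 subrr eq_sym oner_neq0.
Qed.

Definition rowx (s : 'M[A]_2) := lat (s 1 0) (s 1 1).
Definition rowy (s : 'M[A]_2) := lat (s 0 0) (s 0 1).
Definition tau (s : 'M[A]_2) : C := (rowx s ^+ r.+1 * rowy s)^-1.

(** An entry is at most K times the lattice vector of its row. That vector cancels one factor of
    [tau], and the q remaining factors have inverses of size at most K. *)
Lemma tau_null : null_family (fun s : SL2 => tau (val s)).
Proof.
apply: (@null_matrices _ _ _ _ normT (fun s => \det s == 1) _ (K * K ^+ r.+1)).
move=> [s /= /eqP s1] a b.
have x0 := det1_row1 s1; have y0 := det1_row0 s1.
have xK := lat_inv_le x0; have yK := lat_inv_le y0.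
have n0 (x : C) := nrm_ge0 x.
have K0' := ltW K0.
have xr : nrm (rowx s)^-1 ^+ r <= K ^+ r by apply: lerXn2r; rewrite ?nnegrE.
have [/ltW ax ay] : 0 < nrm (rowx s) /\ 0 < nrm (rowy s).
  by rewrite !nrm_gt0 !lat_neq0.
have row_le (i j : 'I_2) :
  nrm (iota (s i j)) <= K * nrm (if i == 0 then rowy s else rowx s).
  move: i j; apply: I2P; apply: I2P; rewrite /= /rowx /rowy /lat;
   by case: (zK (s 0 0) (s 0 1)) => ? ?; case: (zK (s 1 0) (s 1 1)).
apply: le_trans (_ : nrm (tau s) * (K * nrm (if a == 0 then rowy s else rowx s)) <= _).
  by apply: ler_wpM2l.
rewrite mulrCA ler_pM2l // -nrmM /tau.
have rx0 : rowx s != 0 by exact: lat_neq0.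
have ry0 : rowy s != 0 by exact: lat_neq0.
case: (a == 0).
  have -> : (rowx s ^+ r.+1 * rowy s)^-1 * rowy s = (rowx s)^-1 ^+ r * (rowx s)^-1.
    by rewrite invfM mulfVK // -exprSr exprVn.
  by rewrite nrmM nrmX exprSr; apply: ler_pM; rewrite ?exprn_ge0.
have -> : (rowx s ^+ r.+1 * rowy s)^-1 * rowx s = (rowx s)^-1 ^+ r * (rowy s)^-1.
  by rewrite exprSr !invfM mulrAC mulfVK // exprVn.
by rewrite nrmM nrmX exprSr; apply: ler_pM; rewrite ?exprn_ge0.
Qed.

Lemma lat_line (s : 'M[A]_2) c d : k c * latX iota z s + k d * latY iota z s =
  lat (c%:P * s 1 0 + d%:P * s 1 1) (- (c%:P * s 0 0 + d%:P * s 0 1)).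
Proof. by rewrite /lat /latX /latY rmorphN !rmorphD !rmorphM /=; ring. Qed.

Lemma det1_line (s : 'M[A]_2) (c d : F) : \det s = 1 -> (c, d) != (0, 0) ->
  (c%:P * s 1 0 + d%:P * s 1 1 != 0) || (- (c%:P * s 0 0 + d%:P * s 0 1) != 0).
Proof.
move=> s1 cd; rewrite -negb_and oppr_eq0; apply: contra cd => /andP[/eqP e1 /eqP e0].
have E1 : c%:P * \det s = 0.
  rewrite det2; transitivity (s 1 1 * (c%:P * s 0 0 + d%:P * s 0 1)
    - s 0 1 * (c%:P * s 1 0 + d%:P * s 1 1)); first by ring.
  by rewrite e1 e0 !mulr0 subrr.
have E2 : d%:P * \det s = 0.
  rewrite det2; transitivity (s 0 0 * (c%:P * s 1 0 + d%:P * s 1 1)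
    - s 1 0 * (c%:P * s 0 0 + d%:P * s 0 1)); first by ring.
  by rewrite e1 e0 !mulr0 subrr.
move/eqP: E1; move/eqP: E2; rewrite s1 !mulr1 !polyC_eq0 => /eqP -> /eqP ->.
by rewrite eqxx.
Qed.

(** The Moore determinant is a product of q + 1 nonzero lattice vectors; one cancels against the
    entry's bound and the others have inverses of size at most K. *)
Lemma gamma_null : null_family (fun g : GammaT F =>
  (moore2 F (latX iota z (val g)) (latY iota z (val g)))^-1).
Proof.
apply: (@null_matrices _ _ _ _ normT _ _ (K * K ^+ r.+1)).
move=> g a b; set s := val g.
have s1 : \det s = 1 by exact: GammaT_det.
have line_le (c d : F) : (c, d) != (0, 0) ->
    nrm (k c * latX iota z s + k d * latY iota z s)^-1 <= K.
  by move=> cd; rewrite lat_line; apply/lat_inv_le/det1_line.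
have K0' := ltW K0.
have moore_le (x y : C) : (forall c, nrm (y + k c * x)^-1 <= K) -> x != 0 ->
    nrm (moore2 F x y)^-1 * nrm x <= K ^+ r.+1.
  move=> yK x0; rewrite -nrmM (moore2_prod iota) invfM mulrAC mulVf // mul1r.
  rewrite -prodfV nrm_prod.
  apply: le_trans (_ : \prod_(c : F) K <= _); last by rewrite prodr_const card_predK.
  by apply: ler_prod => c _; rewrite nrm_ge0 yK.
have lat0 i : nrm (iota (s i 0)) <= K * nrm (latX iota z s).
  have -> : latX iota z s = lat (s 1 0) (- s 0 0) by rewrite /lat rmorphN.
  case: (zK (s 1 0) (- s 0 0)); rewrite -!/(lat _ _) => h1; rewrite rmorphN nrmN => h0.
  by move: i; apply: I2P.
have lat1 i : nrm (iota (s i 1)) <= K * nrm (latY iota z s).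
  have -> : latY iota z s = lat (s 1 1) (- s 0 1) by rewrite /lat rmorphN.
  case: (zK (s 1 1) (- s 0 1)); rewrite -!/(lat _ _) => h1; rewrite rmorphN nrmN => h0.
  by move: i; apply: I2P.
have neq10 c : (1, c) != (0, 0) :> F * F by rewrite xpair_eqE oner_eq0.
have neq01 c : (c, 1) != (0, 0) :> F * F by rewrite xpair_eqE oner_eq0 andbF.
have line_neq0 c d : (c, d) != (0, 0) -> k c * latX iota z s + k d * latY iota z s != 0.
  by move=> cd; rewrite lat_line; apply/lat_neq0/det1_line.
move: b; apply: I2P.
  apply: le_trans (_ : nrm (moore2 F (latX iota z s) (latY iota z s))^-1 *
    (K * nrm (latX iota z s)) <= _); first by rewrite ler_wpM2l ?nrm_ge0 ?lat0.
  rewrite mulrCA ler_pM2l //; apply: moore_le => [c|].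
    by have := line_le _ _ (neq01 c); rewrite rmorph1 mul1r addrC.
  by have := line_neq0 _ _ (neq10 0); rewrite !rmorph0 !rmorph1 mul1r mul0r addr0.
apply: le_trans (_ : nrm (moore2 F (latX iota z s) (latY iota z s))^-1 *
  (K * nrm (latY iota z s)) <= _); first by rewrite ler_wpM2l ?nrm_ge0.
rewrite moore2_sym invrN nrmN mulrCA ler_pM2l //; apply: moore_le => [c|].
  by have := line_le _ _ (neq10 c); rewrite rmorph1 mul1r.
by have := line_neq0 _ _ (neq01 0); rewrite !rmorph0 !rmorph1 mul1r mul0r add0r.
Qed.

Definition SL2F := {s : 'M[F]_2 | \det s == 1}.

Lemma SL2F_mul_subproof (g : GammaT F) (s : SL2F) :
  \det (map_mx polyC (val s) *m invmx (val g)) == 1.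
Proof.
by rewrite det_mulmx det_inv GammaT_det invr1 mulr1 det_map_mx (eqP (valP s)) rmorph1.
Qed.

Definition SL2F_mul (x : GammaT F * SL2F) : SL2 :=
  exist (fun s => \det s == 1) _ (SL2F_mul_subproof x.1 x.2).

Lemma GammaT_unit (g : GammaT F) : val g \in unitmx.
Proof. by rewrite unitmxE GammaT_det unitr1. Qed.

Lemma eval0_polyC (s : 'M[F]_2) : map_mx (horner_eval 0) (map_mx polyC s) = s.
Proof. by apply/matrixP => a b; rewrite !mxE /horner_eval hornerC. Qed.

(** Evaluation at 0 recovers [s] from s g^-1, and its kernel on SL_2(A) is Gamma(T). *)
Lemma SL2F_mul_bij : bijective SL2F_mul.
Proof.
apply: inj_surj_bijective => [[g s] [g' s'] /(congr1 val) /= E|[s /= s1]].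
  have ginv (h : GammaT F) : map_mx (horner_eval 0) (invmx (val h)) = 1%:M.
    have : map_mx (horner_eval 0) (val h *m invmx (val h)) = 1%:M.
      by rewrite mulmxV ?GammaT_unit // map_mx1.
    by rewrite map_mxM GammaT_eval0 mul1mx.
  have ss : s = s'.
    apply/val_inj; move/(congr1 (map_mx (horner_eval 0))): E.
    by rewrite !map_mxM !eval0_polyC !ginv !mulmx1.
  have sU : map_mx polyC (val s') \in unitmx.
    by rewrite unitmxE det_map_mx (eqP (valP s')) rmorph1 unitr1.
  congr (_, _) => //; apply/val_inj/(can_inj (@invmxK _ _)).
  move: E; rewrite ss => /(congr1 (mulmx (invmx (map_mx polyC (val s'))))).
  by rewrite !(mulKmx sU).
have sU : s \in unitmx by rewrite unitmxE (eqP s1) unitr1.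
pose s0 := map_mx (horner_eval 0) s.
have s0P : \det s0 == 1 by rewrite det_map_mx (eqP s1) /= /horner_eval hornerC.
have gP : (invmx s *m map_mx polyC s0 \in unitmx) &&
    (map_mx (in_qpoly 'X) (invmx s *m map_mx polyC s0) == 1%:M).
  apply/GammaT_P; split.
    by rewrite det_mulmx det_inv (eqP s1) invr1 mul1r det_map_mx (eqP s0P) rmorph1.
  move=> a b; suff /(congr1 (fun M : 'M_2 => M a b)) :
    map_mx (horner_eval 0) (invmx s *m map_mx polyC s0) = 1%:M by rewrite !mxE.
  by rewrite map_mxM eval0_polyC -map_mxM mulVmx // map_mx1.
exists (Sub (invmx s *m map_mx polyC s0) gP : GammaT F, Sub s0 s0P : SL2F).
apply/val_inj => /=; rewrite -{1}(mulKVmx sU (map_mx polyC s0)) mulmxK //.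
by case/andP: gP.
Qed.

Lemma invmx_det1 (M : 'M[A]_2) : \det M = 1 ->
  invmx M = mx22 (M 1 1) (- M 0 1) (- M 1 0) (M 0 0).
Proof.
move=> M1; have MU : M \in unitmx by rewrite unitmxE M1 unitr1.
rewrite -[RHS](mulKmx MU); suff -> : M *m mx22 (M 1 1) (- M 0 1) (- M 1 0) (M 0 0) = 1%:M.
  by rewrite mulmx1.
apply/matrixP; apply: I2P; apply: I2P; rewrite !mxE sum_I2 !mxE /= ?mulr1n ?mulr0n -?M1 ?det2; ring.
Qed.

Lemma sum_tau_SL2F (g : GammaT F) :
  \sum_(s : SL2F) tau (val (SL2F_mul (g, s))) =
  - (moore2 F (latX iota z (val g)) (latY iota z (val g)))^-1.
Proof.
(* These are the rows of g^-1 applied to the column (z, 1). *)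
pose u := latY iota z (val g); pose v := - latX iota z (val g).
transitivity (\sum_(s : 'M[F]_2 | \det s == 1)
  ((k (s 1 0) * u + k (s 1 1) * v) ^+ r.+1 * (k (s 0 0) * u + k (s 0 1) * v))^-1).
  rewrite (big_sub [pred s : 'M[F]_2 | \det s == 1]) /=.
  apply: eq_bigr => s _; rewrite /tau /rowx /rowy /lat invmx_det1 ?GammaT_det //.
  rewrite !mxE !sum_I2 !mxE /= /u /v /latX /latY.
  rewrite !(rmorphD, rmorphM, rmorphN) /=.
  congr (_ ^+ _ * _)^-1; ring.
rewrite (sum_SL2 p_pr card_F) => [|c d cd].
  by rewrite /moore2 (frobN iota p_pr card_F) /u /v; congr (- _^-1); ring.
have -> : k c * u + k d * v = k (- d) * latX iota z (val g) + k c * latY iota z (val g).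
  by rewrite polyCN rmorphN /u /v; ring.
rewrite lat_line; apply/lat_neq0/det1_line; first exact: GammaT_det.
by move: cd; rewrite !xpair_eqE oppr_eq0 andbC.
Qed.

Lemma sum_GammaT l : sums_to (fun s : SL2 => tau (val s)) l ->
  sums_to (fun g : GammaT F => - (moore2 F (latX iota z (val g)) (latY iota z (val g)))^-1) l.
Proof.
move=> tl; apply: (sums_to_fubini (x := (fun s : SL2 => tau (val s)) \o SL2F_mul)).
- exact: null_family_bij SL2F_mul_bij tau_null.
- exact: sums_to_bij SL2F_mul_bij tl.
by move=> g; rewrite -sum_tau_SL2F; exact: sums_to_fin.
Qed.

Local Notation cosets := {eq_quot (K_coset_equiv_rel F)}.

Definition translate (M : 'M[A]_2) (a : A) : 'M[A]_2 :=
  mx22 (((\det M)`_0)^-1%:P * (M 0 0 - a * M 1 0))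
       (((\det M)`_0)^-1%:P * (M 0 1 - a * M 1 1)) (M 1 0) (M 1 1).

Lemma translate_det (M : 'M[A]_2) a : M \in unitmx -> \det (translate M a) == 1.
Proof.
move=> /poly_det_unit[d d0 dM]; rewrite det2 !mxE /= dM coefC /=.
apply/eqP; transitivity (d^-1%:P * \det M); first by rewrite det2; ring.
by rewrite dM -polyCM mulVf.
Qed.

Definition coset_translate (x : cosets * A) : SL2 :=
  exist (fun s => \det s == 1) _ (translate_det x.2 (valP (repr x.1))).

Lemma in_KP (m : 'M[A]_2) : in_K m <-> exists c d, c != 0 /\ m = mx22 c%:P d 0 1.
Proof. by []. Qed.

(** The elements of determinant 1 in K are the unipotent translations, so each coset meets SL_2(A)
    in a single orbit on which A acts freely. *)
Lemma coset_translate_bij : bijective coset_translate.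
Proof.
apply: inj_surj_bijective => [[x a] [y b] /(congr1 val) /= E|[s /= s1]].
  have E0 := E; have xU := valP (repr x); have yU := valP (repr y).
  have [c c0 cM] := poly_det_unit xU; have [d d0 dN] := poly_det_unit yU.
  move: E cM dN; set M := val (repr x); set N := val (repr y) => E cM dN.
  have E' i j := congr1 (fun m : 'M_2 => m i j) E.
  have := E' 0 0; have := E' 0 1; have := E' 1 0; have := E' 1 1.
  rewrite !mxE /= cM dN !coefC /= => e11 e10 e01 e00.
  have scal (f g : A) : c^-1%:P * f = d^-1%:P * g -> g = (d / c)%:P * f.
    move=> fg; rewrite polyCM -mulrA fg mulrA -polyCM divff // mul1r.
    by [].
  move: e00 e01; rewrite e11 e10 => /scal e00 /scal e01.
  have xy : x = y.
    rewrite -(reprK x) -(reprK y); apply/eqquotP; apply/asboolP.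
    exists (mx22 (d / c)%:P (b - (d / c)%:P * a) 0 1).
      by apply/in_KP; exists (d / c), (b - (d / c)%:P * a); split; rewrite // mulf_neq0 ?invr_eq0.
    apply/matrixP; apply: I2P; apply: I2P; rewrite -/M -/N !mxE sum_I2 !mxE /= ?e11 ?e10; last 2 first.
    - by ring.
    - by ring.
    - by move/eqP: e00; rewrite subr_eq => /eqP ->; ring.
    by move/eqP: e01; rewrite subr_eq => /eqP ->; ring.
  congr (_, _) => //.
  move: E0; rewrite -xy; have [d' d'0 /=] := poly_det_unit (valP (repr x)).
  move: (sval (repr x)) => M' dM' E0.
  have di0 : (d'^-1)%:P != 0 :> A by rewrite polyC_eq0 invr_eq0.
  have e0 i : (a - b) * M' 1 i = 0.
    move: (congr1 (fun m : 'M_2 => m 0 i) E0); move: i; apply: I2P; rewrite !mxE /= dM' coefC /=;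
      by move=> /(mulfI di0)/addrI/oppr_inj e0; rewrite mulrBl e0 subrr.
  have : (a - b) * \det M' = 0.
    rewrite det2; transitivity (M' 0 0 * ((a - b) * M' 1 1) - M' 0 1 * ((a - b) * M' 1 0)); first by ring.
    by rewrite !e0 !mulr0 subrr.
  by rewrite dM' => /eqP; rewrite mulf_eq0 polyC_eq0 (negbTE d'0) orbF subr_eq0 => /eqP.
have sU : s \in unitmx by rewrite unitmxE (eqP s1) unitr1.
pose g : GL2A F := Sub s sU.
(* The representative of the coset of [s] is [m *m s]; subtracting [d] times the second row and
   dividing by [c] undoes [m]. *)
have /eqquotP/asboolP[m /in_KP[c [d [c0 ->]]]] : g = repr (\pi_cosets g) %[mod cosets].
  by rewrite reprK.
rewrite [val g]/= => sE; exists (\pi_cosets g, d); apply/val_inj => /=.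
rewrite /translate sE det_mulmx (eqP s1) mulr1 det2 !mxE sum_I2 !mxE /=.
rewrite !sum_I2 !mxE /= mulr1 mulr0 subr0 coefC /=.
have cK (f : A) : c^-1%:P * (c%:P * f) = f by rewrite mulrA -polyCM mulVf // mul1r.
by apply/matrixP; apply: I2P; apply: I2P; rewrite !mxE /= !(mul0r, mul1r, add0r) ?addrK ?cK.
Qed.

(** With w = N/j the coset's summand is det M / j^(q+1) times the sum of the 1/(w - a), and its term
    at [a] is [tau] of the corresponding matrix in SL_2(A). *)
Lemma h_sum l : sums_to (fun s : SL2 => tau (val s)) l -> h iota z = l.
Proof.
move=> tl; apply: usumE.
apply: (sums_to_fubini (x := (fun s : SL2 => tau (val s)) \o coset_translate)).
- exact: null_family_bij coset_translate_bij tau_null.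
- exact: sums_to_bij coset_translate_bij tl.
move=> x; pose M0 := val (repr x); pose M := map_mx iota M0.
change (sums_to (fun a => tau (translate M0 a))
  (\det M / automorphy M z ^+ (#|F| + 1) * t_A iota (mobius M z))).
have [d d0 dM] := poly_det_unit (valP (repr x)).
pose j := lat (M0 1 0) (M0 1 1); pose N := lat (M0 0 0) (M0 0 1).
have jE : automorphy M z = j by rewrite /automorphy /M !mxE.
have wE : mobius M z = N / j by rewrite /mobius jE /M !mxE.
have nz1 : (M0 1 0 != 0) || (M0 1 1 != 0).
  by have := det1_row1 (eqP (translate_det 0 (valP (repr x)))); rewrite !mxE.
have j0 : j != 0 by exact: lat_neq0.
have kd0 : k d != 0 by rewrite (iota_const_eq0 (L := C)).
have rowyE a : lat (d^-1%:P * (M0 0 0 - a * M0 1 0)) (d^-1%:P * (M0 0 1 - a * M0 1 1)) =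
    (k d)^-1 * (N - iota a * j).
  have <- : k (d^-1) = (k d)^-1 by exact: (fmorphV (iota \o polyC)).
  by rewrite /lat /N /j /lat !rmorphM !rmorphB !rmorphM /=; ring.
have Na a : N - iota a * j != 0.
  have := det1_row0 (eqP (translate_det a (valP (repr x)))).
  rewrite !mxE /= => /lat_neq0; rewrite dM coefC /= rowyE.
  by rewrite mulf_eq0 negb_or => /andP[].
have wA a : N / j != iota a.
  by apply: contraNneq (Na a) => NE; rewrite -NE divfK // subrr.
have tw := t_A_sum p_pr card_F normT Ccomp wA.
rewrite jE wE.
have := sums_toZ (\det M / j ^+ (#|F| + 1)) tw.
congr (sums_to _ _); apply/funext => a /=.
rewrite /tau /rowx /rowy !mxE /= dM coefC /=.
have -> : \det M = k d by rewrite det_map_mx dM.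
rewrite -/M0 rowyE -/j addn1 card_predK.
have := Na a; rewrite exprSr => na0; have jq : j ^+ #|F| != 0 by rewrite expf_neq0.
have -> : N / j - iota a = (N - iota a * j) / j by rewrite mulrBl mulfK.
move: (N - _) na0 (j ^+ _) jq => y y0 J J0.
by field; rewrite ?kd0 ?y0 ?J0 ?j0.
Qed.
End HSum.

(** * The series f *)

Section FSeries.
Variables (R : realType) (F : finFieldType) (C : valuedField R).
Variable iota : {rmorphism {poly F} -> C}.
Variable z : C.
Local Notation r := #|F|.-1.
Local Notation k c := (iota c%:P).
Local Notation A := {poly F}.

(* Homogeneous coordinates of a point of P^1(F). *)
Definition hom1 (x : option F) : F := if x is Some y then y else 1.
Definition hom2 (x : option F) : F := if x is Some _ then 1 else 0.

Definition ell (g : 'M[A]_2) (x : option F) : C :=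
  k (hom1 x) * latX iota z g + k (hom2 x) * latY iota z g.

Definition den (g : 'M[A]_2) (x : option F) : C :=
  iota (g 1 0) * k (hom1 x) + iota (g 1 1) * k (hom2 x).

(** One has z - g x = ell/den, and [den] vanishes exactly when g x is infinite, so the formula
    agrees with the convention at infinity. *)
Lemma poleE (g : 'M[A]_2) x : ell g x != 0 ->
  (if P1act (map_mx iota g) (P1const iota x) is Some y then (z - y)^-1 else 0) =
  den g x / ell g x.
Proof.
move=> l0; pose num := iota (g 0 0) * k (hom1 x) + iota (g 0 1) * k (hom2 x).
have lE : ell g x = den g x * z - num by rewrite /ell /den /num /latX /latY; ring.
have -> : P1act (map_mx iota g) (P1const iota x) =
    if den g x == 0 then None else Some (num / den g x).
  by case: x @num {l0 lE} => [y|]; rewrite /P1act /den /= !mxE ?rmorph1 ?rmorph0 !(mulr1, mulr0, addr0).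
have [->|d0] := eqVneq (den g x) 0; first by rewrite mul0r.
rewrite lE in l0 *; have -> : z - num / den g x = (den g x * z - num) / den g x.
  by field.
by rewrite invf_div.
Qed.

(** The numerator is [\det g] times the determinant of the homogeneous coordinates, so it depends
    neither on [z] nor on [g]. *)
Lemma uE (g : 'M[A]_2) a b : \det g = 1 -> ell g a != 0 -> ell g b != 0 ->
  u z (P1act (map_mx iota g) (P1const iota a)) (P1act (map_mx iota g) (P1const iota b)) =
  k (hom2 a * hom1 b - hom1 a * hom2 b) / (ell g a * ell g b).
Proof.
move=> g1 la lb; rewrite /u !poleE //.
have -> : k (hom2 a * hom1 b - hom1 a * hom2 b) =
   den g b * ell g a - den g a * ell g b.
  rewrite -[LHS]mulr1 -(rmorph1 iota) -g1 det2 polyCB !polyCM !rmorphB !rmorphM /=.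
  by rewrite /ell /den /latX /latY; ring.
by field; rewrite la lb.
Qed.

Lemma hom_neq0 a b : a != b -> hom2 a * hom1 b - hom1 a * hom2 b != 0.
Proof.
case: a b => [a|] [b|] //=; rewrite ?mul1r ?mul0r ?mulr1 ?mulr0 ?sub0r ?subr0 ?oppr_eq0 ?oner_eq0 //.
by rewrite subr_eq0 eq_sym => ab; apply: contra ab => /eqP ->.
Qed.

(** The linear factors of the Moore determinant are indexed by the projective line over F, infinity
    giving [latX]. *)
Lemma prod_ell (g : 'M[A]_2) : \prod_x ell g x = moore2 F (latX iota z g) (latY iota z g).
Proof.
rewrite (moore2_prod iota) (bigD1 None) //= {1}/ell /= rmorph1 rmorph0 mul1r mul0r addr0.
congr (_ * _); rewrite (reindex_omap Some id) => [|[]] //=.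
by apply: eq_big => [c|c _]; rewrite ?eqxx // /ell /= rmorph1 mul1r addrC.
Qed.

Lemma prod_pairs (T : Type) (idx : T) (op : Monoid.com_law idx)
    (a b : 'I_((#|F| + 1) %/ 2) -> option F) (f : option F -> T) :
  pair_decomposition a b ->
  \big[op/idx]_x f x = \big[op/idx]_i op (f (a i)) (f (b i)).
Proof.
move=> [ab triv cov].
pose g (x : 'I_((#|F| + 1) %/ 2) * bool) := if x.2 then a x.1 else b x.1.
have gbij : bijective g.
  apply: inj_surj_bijective => [[i s] [j t]|x].
    rewrite /g /= => gE; have ij : i = j.
      apply: (triv i j) => //; exists (if s then a i else b i).
      by split; [case: s gE => _; [left|right] | rewrite gE; case: t gE => _; [left|right]].
    subst j; congr (_, _); case: s t gE => -[] // E; have := ab i; rewrite E eqxx //.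
  have : (\bigcup_i [set a i; b i])%classic x by rewrite cov.
  by move=> [i _ [->|->]]; [exists (i, true) | exists (i, false)].
rewrite (reindex g) /=; last by apply: onW_bij.
rewrite -(pair_bigA _ (fun i s => f (g (i, s)))) /=.
by apply: eq_bigr => i _; rewrite big_bool.
Qed.
End FSeries.

Lemma sum_exp_pchar (L : fieldType) (I : Type) (s : seq I) (x : I -> L) n :
  [pchar L].-nat n -> (\sum_(i <- s) x i) ^+ n = \sum_(i <- s) x i ^+ n.
Proof.
move=> nL; apply: (big_morph (fun y => y ^+ n)) => [a b|]; first exact: exprDn_pchar.
by rewrite expr0n gtn_eqF //; case/andP: nL.
Qed.

(** * Passage to the limit and the two identities *)

Section Main.
Variables (R : realType) (F : finFieldType) (C : valuedField R).
Variable iota : {rmorphism {poly F} -> C}.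
Variables (p e : nat).
Hypotheses (p_pr : prime p) (card_F : #|F| = (p ^ e)%N) (q_odd : odd #|F|).
Hypothesis HC : is_Cinfty iota.
Variable z : C.
Hypothesis zO : Omega iota z.
Local Notation r := #|F|.-1.
Local Notation k c := (iota c%:P).
Local Notation sterm g := (moore2 F (latX iota z (val g)) (latY iota z (val g)))^-1.

Let normT : nrm (iota 'X) = #|F|%:R :> R := Cinfty_normT HC.
Let Ccomp := Cinfty_complete HC.

Definition boxes n : {fset GammaT F} := sub_matrices _ n.

Lemma independent_Omega : independent iota (-1) z.
Proof.
have [K K1 zK] := Omega_bound normT zO.
move=> a b; rewrite addrC mulrN1 -rmorphN => ab0.
have := zK b (- a); rewrite ab0 nrm0 mulr0 => -[].
rewrite !le_eqVlt !ltNge !nrm_ge0 !orbF !nrm_eq0 !(iota_eq0 normT) oppr_eq0.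
by move=> /eqP -> /eqP ->.
Qed.

(** For the basis -1, z both sides are powers of the same closed form, by [ball_sum_GammaT] with
    exponents [n] and 1. *)
Lemma box_sum m n : (0 < n <= r)%N ->
  \sum_(g <- boxes m.+1) sterm g ^+ n = (\sum_(g <- boxes m.+1) sterm g) ^+ n.
Proof.
move=> nr; have one : (0 < 1 <= r)%N by rewrite pred_card_gt0.
have inB (g : GammaT F) : in_box (1%:M *m val g) m.+1 m.+1 = (g \in boxes m.+1).
  rewrite mul1mx; apply/idP/idP => [/forallP gB|/sub_matrices_size gB]; last first.
    by apply/forallP => b; rewrite !gB.
  by apply: in_sub_matrices => a b; move: a; apply: I2P; case/andP: (gB b).
have S_n l : (0 < l <= r)%N ->
    \sum_(g <- boxes m.+1) sterm g ^+ l = (ball_sum iota (-1) z m m / k 1) ^+ l.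
  move=> lr; rewrite -(@ball_sum_GammaT _ _ _ _ _ p_pr card_F q_odd z l m m 1%:M _ _ 1 (boxes m.+1)) ?fset_uniq //.
  - rewrite big_seq; apply: eq_big => g; first by rewrite inB.
    by rewrite exprVn.
  - by rewrite oner_eq0.
  - by rewrite det1.
  - by rewrite !mxE /= rmorph0 rmorph1 mul0r addr0 mul1r.
  - by rewrite !mxE /= rmorph0 rmorph1 mul0r add0r mul1r.
  - exact: independent_Omega.
  by move=> g; rewrite inB.
rewrite S_n //; congr (_ ^+ n).
by have := S_n 1%N one; rewrite expr1 => <-.
Qed.

Lemma box_sum_pchar m j n : (0 < n <= r)%N ->
  \sum_(g <- boxes m.+1) sterm g ^+ (p ^ j * n)
    = (\sum_(g <- boxes m.+1) sterm g) ^+ (p ^ j * n).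
Proof.
move=> nr; have pL : [pchar C].-nat (p ^ j)%N.
  by rewrite (eq_pnat _ (pcharf_eq (pchar_p iota p_pr card_F))) pnatX pnat_id.
rewrite mulnC exprM -(box_sum m nr) sum_exp_pchar //.
by apply: eq_bigr => g _; rewrite exprM.
Qed.

Lemma sterm_null : null_family (fun g : GammaT F => sterm g).
Proof. by have [K K1 zK] := Omega_bound normT zO; exact: (gamma_null normT K1 zK). Qed.

Lemma sterm_exhaust (g : GammaT F) : exists M, forall m, (M <= m)%N -> g \in boxes m.+1.
Proof.
exists (\max_(ab : 'I_2 * 'I_2) size (val g ab.1 ab.2)) => m Mm.
apply: in_sub_matrices => a b; apply: leqW; apply: leq_trans Mm.
exact: (leq_bigmax (a, b)).
Qed.

(** The boxes exhaust Gamma(T), so the identity of partial sums survives in the limit. *)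
Lemma sterm_sum_pow j n E1 En : (0 < n <= r)%N ->
  sums_to (fun g : GammaT F => sterm g) E1 ->
  sums_to (fun g : GammaT F => sterm g ^+ (p ^ j * n)) En -> En = E1 ^+ (p ^ j * n).
Proof.
move=> nr H1 Hn.
have s1 := seqlimX (p ^ j * n) (netlim_seq sterm_exhaust H1).
apply: seqlim_uniq (netlim_seq sterm_exhaust Hn) _ => eps /s1[M HM].
by exists M => m /HM; rewrite box_sum_pchar.
Qed.

Section Pairs.
Variables a b : 'I_((#|F| + 1) %/ 2) -> option F.
Hypothesis ab : pair_decomposition a b.

Definition pair_const : F := \prod_i (hom2 (a i) * hom1 (b i) - hom1 (a i) * hom2 (b i)).

Lemma pair_const_neq0 : pair_const != 0.
Proof. by apply/prodf_neq0 => i _; case: ab => H _ _; exact: hom_neq0. Qed.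

(** The pairs partition the projective line, so the denominators multiply to the Moore determinant,
    while the numerators multiply to the constant [pair_const]. *)
Lemma f_term kappa (g : GammaT F) :
  \prod_i u z (P1act (map_mx iota (val g)) (P1const iota (a i)))
              (P1act (map_mx iota (val g)) (P1const iota (b i))) ^+ kappa
  = k pair_const ^+ kappa * sterm g ^+ kappa.
Proof.
have l0 x : ell iota z (val g) x != 0.
  have [K K1 zK] := Omega_bound normT zO.
  rewrite /ell lat_line; apply/(lat_neq0 normT K1 zK)/det1_line; first exact: GammaT_det.
  by case: x => [x|] /=; rewrite xpair_eqE oner_eq0 ?andbF.
rewrite prodrXl -exprMn; congr (_ ^+ kappa).
rewrite -prod_ell (prod_pairs _ _ ab)
  -[\big[_/_]_i (_ * _)]/(\prod_i (ell iota z (val g) (a i) * ell iota z (val g) (b i))).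
have -> : k pair_const = \prod_i k (hom2 (a i) * hom1 (b i) - hom1 (a i) * hom2 (b i)).
  exact: (rmorph_prod (iota \o polyC)).
rewrite -prodf_div.
by apply: eq_bigr => i _; rewrite uE ?GammaT_det.
Qed.

Lemma f_seriesE kappa E : sums_to (fun g : GammaT F => sterm g ^+ kappa) E ->
  f_series iota a b kappa z = k pair_const ^+ kappa * E.
Proof.
move=> H; apply: usumE; have := sums_toZ (k pair_const ^+ kappa) H.
by congr (sums_to _ _); apply/funext => g; rewrite f_term.
Qed.

Lemma f_series_pow j n : (0 < n <= r)%N ->
  f_series iota a b (p ^ j * n) z = f_series iota a b 1 z ^+ (p ^ j * n).
Proof.
move=> nr; have [E1 H1] := null_sums_to Ccomp sterm_null.
have n0 : (0 < p ^ j * n)%N by rewrite muln_gt0 expn_gt0 prime_gt0 //; case/andP: nr.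
have [En Hn] := null_sums_to Ccomp (null_familyX n0 sterm_null).
rewrite (f_seriesE Hn) (@f_seriesE 1 E1) ?expr1 //.
by rewrite (sterm_sum_pow nr H1 Hn) exprMn.
Qed.

(** The two regroupings give h = -E1. In the power q - 1 the sign disappears because q is odd, and
    [pair_const] because it is a nonzero constant. *)
Lemma Delta_f_series : Delta iota z = - f_series iota a b 1 z ^+ r.
Proof.
have [K K1 zK] := Omega_bound normT zO.
have [E1 H1] := null_sums_to Ccomp sterm_null.
have [l Hl] := null_sums_to Ccomp (tau_null normT K1 zK).
have hE := h_sum p_pr card_F normT Ccomp K1 zK Hl.
have E1E : l = -1 * E1.
  have := sum_GammaT p_pr card_F normT K1 zK Hl.
  move/netlim_uniq; apply; have := sums_toZ (-1) H1.
  by congr (sums_to _ _); apply/funext => g; rewrite mulN1r.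
have eps1 : k pair_const ^+ r = 1.
  have k0 : k pair_const != 0 by rewrite (iota_const_eq0 (L := C)) pair_const_neq0.
  by apply: (mulfI k0); rewrite -exprS (frob_const (L := C)) mulr1.
rewrite /Delta hE E1E mulN1r (@f_seriesE 1 E1) ?expr1 // exprMn eps1 mul1r subn1.
by rewrite (exprN_even (L := C) q_odd).
Qed.
End Pairs.
End Main.

Theorem corollary6p4p5 (R : realType) (p e : nat) (F : finFieldType)
    (C : valuedField R) (iota : {rmorphism {poly F} -> C})
    (a b : 'I_((#|F| + 1) %/ 2) -> option F) :
  prime p -> #|F| = (p ^ e)%N -> odd #|F| -> is_Cinfty iota ->
  pair_decomposition a b ->
  (forall kappa j kappa' : nat,
     (1 <= kappa' <= #|F| - 1)%N -> kappa = (p ^ j * kappa')%N ->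
     forall z : C, Omega iota z ->
       f_series iota a b kappa z = f_series iota a b 1 z ^+ kappa) /\
  (forall z : C, Omega iota z ->
     Delta iota z = - f_series iota a b 1 z ^+ (#|F| - 1) /\
     Delta iota z = - f_series iota a b (#|F| - 1) z).
Proof.
move=> p_pr card_F q_odd HC ab; rewrite subn1; split=> [kappa j n nr -> z zO|z zO].
  exact: (f_series_pow p_pr card_F q_odd HC zO ab j nr).
have D := Delta_f_series p_pr card_F q_odd HC zO ab.
split=> //; rewrite D; congr (- _).
have rr : (0 < #|F|.-1 <= #|F|.-1)%N by rewrite pred_card_gt0 leqnn.
have := f_series_pow p_pr card_F q_odd HC zO ab 0 rr.
by rewrite expn0 mul1n => ->.
Qed.
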